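(* The groups $\operatorname{PC}^{\bowtie}$ and $\operatorname{PAff}^{\bowtie}$ are simple.
   Context: $X=[0,1[$. $\widehat{\operatorname{PC}^{\bowtie}}$ is the group of bijections $X\to X$ continuous outside a finite subset of $X$; $\widehat{\operatorname{PAff}^{\bowtie}}$ is its subgroup of bijections $f$ for which there is a finite partition of $X$ into intervals $[a,b[$ such that $f$ is affine on each open interval $]a,b[$. ${\mathfrak S}_{\mathrm{fin}}$ is the (normal) subgroup of finitely supported permutations of $X$, and $\operatorname{PC}^{\bowtie}=\widehat{\operatorname{PC}^{\bowtie}}/{\mathfrak S}_{\mathrm{fin}}$, $\operatorname{PAff}^{\bowtie}=\widehat{\operatorname{PAff}^{\bowtie}}/{\mathfrak S}_{\mathrm{fin}}$. *)

(* Defs.v *)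
From Stdlib Require Import Reals List Arith.
Open Scope R_scope.

Definition X : Type := { x : R | 0 <= x < 1 }.
Definition xv (x : X) : R := proj1_sig x.

Definition inverse_of (f g : X -> X) : Prop :=
  (forall x, g (f x) = x) /\ (forall y, f (g y) = y).

Definition bij (f : X -> X) : Prop := exists g, inverse_of f g.

Definition cont_at (f : X -> X) (x : X) : Prop :=
  forall eps, 0 < eps -> exists delta, 0 < delta /\
    forall y : X, Rabs (xv y - xv x) < delta -> Rabs (xv (f y) - xv (f x)) < eps.

Definition in_PC_hat (f : X -> X) : Prop :=
  bij f /\ exists F : list X, forall x, ~ In x F -> cont_at f x.

Definition in_PAff_hat (f : X -> X) : Prop :=
  bij f /\
  exists (n : nat) (a : nat -> R),
    a 0%nat = 0 /\ a n = 1 /\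
    (forall i, (i < n)%nat -> a i < a (S i)) /\
    (forall i, (i < n)%nat -> exists m c : R,
        forall x : X, a i < xv x < a (S i) -> xv (f x) = m * xv x + c).

Definition fin_supp_perm (h : X -> X) : Prop :=
  bij h /\ exists F : list X, forall x, ~ In x F -> h x = x.

Definition fin_equiv (f g : X -> X) : Prop :=
  exists h, fin_supp_perm h /\ forall x, f x = h (g x).

(* A normal subgroup of the quotient G / S_fin (G given as a set of
   bijections of X), described by its preimage H in G, i.e. a union of
   S_fin-cosets of elements of G which contains the identity and is closed
   under composition, inverses and conjugation by G. *)
Definition quot_normal_subgroup (G H : (X -> X) -> Prop) : Prop :=
  (forall f, H f -> G f) /\
  (forall f g, H f -> G g -> fin_equiv g f -> H g) /\
  H (fun x => x) /\
  (forall f g, H f -> H g -> H (fun x => f (g x))) /\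
  (forall f g, H f -> inverse_of f g -> H g) /\
  (forall f g gi, H f -> G g -> inverse_of g gi -> H (fun x => g (f (gi x)))).

Definition quot_simple (G : (X -> X) -> Prop) : Prop :=
  (exists f, G f /\ ~ fin_equiv f (fun x => x)) /\
  (forall H, quot_normal_subgroup G H ->
     (forall f, H f -> fin_equiv f (fun x => x)) \/ (forall f, G f -> H f)).

(* Main.v *)
Require Import Defs.
From Stdlib Require Import Reals List Arith Lra Lia Ranalysis5.
From Stdlib Require Import Classical ClassicalEpsilon.
From Stdlib Require Import FunctionalExtensionality ProofIrrelevance.

(** Let [H] be a normal subgroup containing some [f] which is not finitely
supported. By continuity [f] displaces an interval, and the double commutator
trick puts into [H] all commutators of elements supported in that interval. In
particular [H] contains the flips (reversals [x -> a + b - x] of an interval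
[(a, b)]) of small subintervals: the flip of an interval is the commutator of
the flip of its middle half with the product of the flips of its two halves.
Conjugating by flips and doubling, [H] contains all flips, and the flip of
[(0, 1)] puts into [H] all commutators of elements supported in [(1/2, 1)].

An element of the group is now reduced to the identity piece by piece, from
left to right. Two flips bring the image of the first piece to the left end
with the right orientation, and an increasing homeomorphism of the remaining
interval turns the piece into the identity. It remains to see that [H] contains
these homeomorphisms.

In the piecewise affine case they have a single break. If [F] is such a map
with fixed point [p] and [s] is a one-break map scaling the support of [F]
towards [p], then [F] times the inverse of its conjugate by [s] is the
identity near [p] and has a single break, and up to conjugation one obtains so
all pairs of slopes. In the piecewise continuous case, any [f] supported in a
fundamental domain of an increasing homeomorphism [s] is the commutator of [s]
with the product of the conjugates of [f] by the powers [s^n], [n >= 0]. *)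

(** * Points of the interval and its bijections *)

Lemma xv_range (x : X) : 0 <= xv x < 1.
Proof. exact (proj2_sig x). Qed.

Lemma xv_inj (x y : X) : xv x = xv y -> x = y.
Proof.
  destruct x as [x hx], y as [y hy]; simpl; intros ->.
  f_equal; apply proof_irrelevance.
Qed.

(** Total, with default value [0] outside [[0, 1)], so that reals can be used before their range is
    known. *)
Definition toX (r : R) : X :=
  match Rle_dec 0 r with
  | left h0 => match Rlt_dec r 1 with
               | left h1 => exist _ r (conj h0 h1)
               | right _ => exist _ 0 (conj (Rle_refl 0) Rlt_0_1)
               end
  | right _ => exist _ 0 (conj (Rle_refl 0) Rlt_0_1)
  end.

Lemma xv_toX (r : R) : 0 <= r < 1 -> xv (toX r) = r.
Proof.
  intros h; unfold toX; destruct (Rle_dec 0 r); [|lra].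
  destruct (Rlt_dec r 1); [reflexivity|lra].
Qed.

Lemma toX_xv (x : X) : toX (xv x) = x.
Proof. apply xv_inj, xv_toX, xv_range. Qed.

Lemma inverse_sym (f g : X -> X) : inverse_of f g -> inverse_of g f.
Proof. intros [h1 h2]; split; assumption. Qed.

Lemma inverse_inj (f g : X -> X) x y : inverse_of f g -> f x = f y -> x = y.
Proof. intros [h1 _] e; rewrite <- (h1 x), <- (h1 y), e; reflexivity. Qed.

Lemma inverse_comp (f fi g gi : X -> X) :
  inverse_of f fi -> inverse_of g gi ->
  inverse_of (fun x => f (g x)) (fun x => gi (fi x)).
Proof.
  intros [f1 f2] [g1 g2]; split; intros x.
  - rewrite f1; apply g1.
  - rewrite g2; apply f2.
Qed.

Lemma bij_comp (f g : X -> X) : bij f -> bij g -> bij (fun x => f (g x)).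
Proof.
  intros [fi hf] [gi hg]; exists (fun x => gi (fi x)); apply inverse_comp; assumption.
Qed.

(** * Equality outside a finite set *)

(** Exceptional points are listed as reals, so that the endpoint [1], which is not a point of [X],
    may be listed too. *)
Definition ae_eq (f g : X -> X) : Prop :=
  exists L : list R, forall x, ~ In (xv x) L -> f x = g x.

Lemma exists_avoiding (L : list R) (a b : R) :
  a < b -> exists z, a < z < b /\ ~ In z L.
Proof.
  (* The induction needs a whole subinterval free of [L]; each further real is avoided by passing to
     one half of it. *)
  assert (sub : forall L u v, u < v ->
    exists u' v', u <= u' < v' /\ v' <= v /\ forall z, u' < z < v' -> ~ In z L).
  { clear; induction L as [|r L IH]; intros u v huv.
    - exists u, v; repeat split; try lra; intros z _ [].
    - destruct (IH u v huv) as (u1 & v1 & h1 & h2 & h3).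
      destruct (Rle_dec r ((u1 + v1) / 2)) as [hr|hr].
      + exists ((u1 + v1) / 2), v1; repeat split; try lra.
        intros z hz [e|i]; [lra|]; apply (h3 z); [lra|exact i].
      + exists u1, ((u1 + v1) / 2); repeat split; try lra.
        intros z hz [e|i]; [lra|]; apply (h3 z); [lra|exact i]. }
  intros hab; destruct (sub L a b hab) as (u & v & h1 & h2 & h3).
  exists ((u + v) / 2); split; [lra|]; apply h3; lra.
Qed.

(** The permutation is [f] after the inverse of [g]; it moves only images under [g] of exceptional
    points. *)
Lemma fin_equiv_of_ae (f g : X -> X) : bij f -> bij g -> ae_eq f g -> fin_equiv f g.
Proof.
  intros hf [gi [g1 g2]] [L hL].
  exists (fun y => f (gi y)); split; [split|].
  - apply bij_comp; [exact hf|]; exists g; split; assumption.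
  - exists (map (fun r => g (toX r)) L); intros y hy.
    rewrite hL; [apply g2|]; intros hin; apply hy, in_map_iff.
    exists (xv (gi y)); split; [rewrite toX_xv; apply g2|exact hin].
  - intros x; rewrite g1; reflexivity.
Qed.

Lemma not_fin_equiv_id_moves (f : X -> X) (L : list R) :
  bij f -> ~ fin_equiv f (fun x => x) ->
  exists x, ~ In (xv x) L /\ f x <> x.
Proof.
  intros hf hn; apply NNPP; intros hno; apply hn, fin_equiv_of_ae; [exact hf| |].
  - exists (fun x => x); split; reflexivity.
  - exists L; intros x hx; apply NNPP; intros hfx; apply hno; exists x; split; assumption.
Qed.

Lemma fin_equiv_id_fixes (f : X -> X) (a b : R) :
  fin_equiv f (fun x => x) -> 0 <= a -> a < b -> b <= 1 ->
  exists x, a < xv x < b /\ f x = x.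
Proof.
  intros (h & [_ [F hF]] & hh) h0 hab h1.
  destruct (exists_avoiding (map xv F) a b hab) as (z & hz & hzL).
  exists (toX z); rewrite xv_toX by lra; split; [exact hz|].
  rewrite hh; apply hF; intros hin; apply hzL, in_map_iff.
  exists (toX z); split; [apply xv_toX; lra|exact hin].
Qed.

(** * Affine maps *)

(* The affine map sending [a] to [c] and [b] to [d]; it reverses the
   orientation when [d < c]. *)
Definition aff (a b c d x : R) : R := c + (x - a) * ((d - c) / (b - a)).

Lemma aff_l a b c d : aff a b c d a = c.
Proof. unfold aff; ring. Qed.

Lemma aff_r a b c d : a <> b -> aff a b c d b = d.
Proof. intros h; unfold aff; field; lra. Qed.

Lemma aff_id a b x : a <> b -> aff a b a b x = x.
Proof. intros h; unfold aff; field; lra. Qed.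

Lemma aff_aff a b c d e f x :
  a <> b -> c <> d -> aff c d e f (aff a b c d x) = aff a b e f x.
Proof. intros h1 h2; unfold aff; field; lra. Qed.

Lemma aff_inv a b c d x : a <> b -> c <> d -> aff c d a b (aff a b c d x) = x.
Proof. intros h1 h2; rewrite aff_aff, aff_id; auto. Qed.

(** Two values determine an affine map. Read from right to left, this changes the reference points
    so that [aff_aff] applies. *)
Lemma aff_restrict a b c d a' b' x :
  a <> b -> a' <> b' ->
  aff a' b' (aff a b c d a') (aff a b c d b') x = aff a b c d x.
Proof. intros h1 h2; unfold aff; field; lra. Qed.

Lemma aff_lt a b c d x y : a < b -> c < d -> x < y -> aff a b c d x < aff a b c d y.
Proof.
  intros h1 h2 h; unfold aff; apply Rplus_lt_compat_l, Rmult_lt_compat_r; [|lra].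
  apply Rdiv_lt_0_compat; lra.
Qed.

Lemma aff_between a b c d x : a < x < b -> c < d -> c < aff a b c d x < d.
Proof.
  intros h1 h2.
  pose proof (aff_lt a b c d a x ltac:(lra) h2 ltac:(lra)).
  pose proof (aff_lt a b c d x b ltac:(lra) h2 ltac:(lra)).
  rewrite aff_l in *; rewrite aff_r in * by lra; lra.
Qed.

Lemma aff_between_le a b c d x : a < b -> a <= x <= b -> c < d -> c <= aff a b c d x <= d.
Proof.
  intros hab h1 h2.
  destruct (Req_dec x a) as [->|]; [rewrite aff_l; lra|].
  destruct (Req_dec x b) as [->|]; [rewrite aff_r; lra|].
  pose proof (aff_between a b c d x ltac:(lra) h2); lra.
Qed.

Definition affine_on (f : X -> X) (u v : R) : Prop :=
  exists m c, forall x : X, u < xv x < v -> xv (f x) = m * xv x + c.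

Lemma affine_on_aff (f : X -> X) u v a b c d :
  (forall x : X, u < xv x < v -> xv (f x) = aff a b c d (xv x)) -> affine_on f u v.
Proof.
  intros h; exists ((d - c) / (b - a)), (c - a * ((d - c) / (b - a))).
  intros x hx; rewrite (h x hx); unfold aff; ring.
Qed.

Lemma affine_on_id (f : X -> X) u v :
  (forall x : X, u < xv x < v -> f x = x) -> affine_on f u v.
Proof. intros h; exists 1, 0; intros x hx; rewrite (h x hx); ring. Qed.

(** * Flips and one-break homeomorphisms *)

(** Reversing the open interval and fixing its ends gives an involution of [X], also when [b] is
    [1]. *)
Definition flip (a b : R) (x : X) : X :=
  if Rlt_dec a (xv x) then if Rlt_dec (xv x) b then toX (a + b - xv x) else x else x.

Lemma flip_in a b x :
  0 <= a -> b <= 1 -> a < xv x < b -> xv (flip a b x) = a + b - xv x.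
Proof.
  intros h0 h1 h; unfold flip.
  destruct (Rlt_dec a (xv x)); [|lra]; destruct (Rlt_dec (xv x) b); [|lra].
  apply xv_toX; lra.
Qed.

Lemma flip_out a b x : xv x <= a \/ b <= xv x -> flip a b x = x.
Proof.
  intros h; unfold flip.
  destruct (Rlt_dec a (xv x)); [|reflexivity]; destruct (Rlt_dec (xv x) b); [lra|reflexivity].
Qed.

Lemma flip_invol a b x : 0 <= a -> b <= 1 -> flip a b (flip a b x) = x.
Proof.
  intros h0 h1; destruct (Rlt_dec a (xv x)) as [ha|ha].
  - destruct (Rlt_dec (xv x) b) as [hb|hb].
    + assert (e := flip_in a b x h0 h1 (conj ha hb)).
      apply xv_inj; rewrite flip_in; lra.
    + rewrite !(flip_out a b x) by lra; reflexivity.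
  - rewrite !(flip_out a b x) by lra; reflexivity.
Qed.

Lemma flip_inverse a b : 0 <= a -> b <= 1 -> inverse_of (flip a b) (flip a b).
Proof. intros h0 h1; split; intros x; apply flip_invol; assumption. Qed.

(* The homeomorphism of [(a, b)] affine on [(a, m)] and [(m, b)] and sending
   [m] to [n], extended by the identity. *)
Definition onebreak (a b m n : R) (x : X) : X :=
  if Rlt_dec a (xv x) then
    if Rlt_dec (xv x) b then
      toX (if Rle_dec (xv x) m then aff a m a n (xv x) else aff m b n b (xv x))
    else x
  else x.

Definition ob_ok (a b m n : R) : Prop := 0 <= a /\ a < m < b /\ a < n < b /\ b <= 1.

Lemma onebreak_out a b m n x : xv x <= a \/ b <= xv x -> onebreak a b m n x = x.
Proof.
  intros h; unfold onebreak.
  destruct (Rlt_dec a (xv x)); [|reflexivity]; destruct (Rlt_dec (xv x) b); [lra|reflexivity].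
Qed.

Lemma onebreak_lo a b m n x : ob_ok a b m n -> a <= xv x <= m ->
  xv (onebreak a b m n x) = aff a m a n (xv x).
Proof.
  intros (h0 & hm & hn & h1) hx.
  destruct (Req_dec (xv x) a) as [e|e].
  - rewrite onebreak_out by lra; rewrite e, aff_l; reflexivity.
  - unfold onebreak; destruct (Rlt_dec a (xv x)); [|lra].
    destruct (Rlt_dec (xv x) b); [|lra]; destruct (Rle_dec (xv x) m); [|lra].
    pose proof (aff_between_le a m a n (xv x)); apply xv_toX; lra.
Qed.

Lemma onebreak_hi a b m n x : ob_ok a b m n -> m <= xv x <= b ->
  xv (onebreak a b m n x) = aff m b n b (xv x).
Proof.
  intros hok hx; pose proof hok as (h0 & hm & hn & h1).
  destruct (Req_dec (xv x) m) as [e|e].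
  - rewrite onebreak_lo by (assumption || lra); rewrite e, aff_l, aff_r; lra.
  - destruct (Req_dec (xv x) b) as [e'|e'].
    + rewrite onebreak_out by lra; rewrite e', aff_r; lra.
    + unfold onebreak; destruct (Rlt_dec a (xv x)); [|lra].
      destruct (Rlt_dec (xv x) b); [|lra]; destruct (Rle_dec (xv x) m); [lra|].
      pose proof (aff_between m b n b (xv x)); apply xv_toX; lra.
Qed.

Lemma ob_ok_sym a b m n : ob_ok a b m n -> ob_ok a b n m.
Proof. unfold ob_ok; tauto. Qed.

Lemma onebreak_cancel a b m n x :
  ob_ok a b m n -> onebreak a b n m (onebreak a b m n x) = x.
Proof.
  intros hok; assert (hok' := ob_ok_sym _ _ _ _ hok).
  pose proof hok as (h0 & hm & hn & h1).
  destruct (Rle_dec (xv x) a) as [ha|ha]; [rewrite !(fun p q => onebreak_out a b p q x) by lra; reflexivity|].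
  destruct (Rle_dec b (xv x)) as [hb|hb]; [rewrite !(fun p q => onebreak_out a b p q x) by lra; reflexivity|].
  destruct (Rle_dec (xv x) m) as [hx|hx]; apply xv_inj.
  - assert (e := onebreak_lo a b m n x hok ltac:(lra)).
    pose proof (aff_between_le a m a n (xv x)).
    rewrite onebreak_lo by (assumption || lra); rewrite e; apply aff_inv; lra.
  - assert (e := onebreak_hi a b m n x hok ltac:(lra)).
    pose proof (aff_between m b n b (xv x)).
    rewrite onebreak_hi by (assumption || lra); rewrite e; apply aff_inv; lra.
Qed.

Lemma onebreak_inverse a b m n :
  ob_ok a b m n -> inverse_of (onebreak a b m n) (onebreak a b n m).
Proof.
  intros h; split; intros x; apply onebreak_cancel; [|apply ob_ok_sym]; exact h.
Qed.

(** Serves to recognise composites and conjugates as one-break maps, by comparing formulas zone by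
    zone. *)
Lemma onebreak_unique a b m n f :
  ob_ok a b m n ->
  (forall x, xv x <= a \/ b <= xv x -> f x = x) ->
  (forall x, a < xv x <= m -> xv (f x) = aff a m a n (xv x)) ->
  (forall x, m < xv x < b -> xv (f x) = aff m b n b (xv x)) ->
  forall x, f x = onebreak a b m n x.
Proof.
  intros hok hout hlo hhi x; pose proof hok as (h0 & hm & hn & h1).
  destruct (Rle_dec (xv x) a); [rewrite hout, onebreak_out by lra; reflexivity|].
  destruct (Rle_dec b (xv x)); [rewrite hout, onebreak_out by lra; reflexivity|].
  apply xv_inj; destruct (Rle_dec (xv x) m).
  - rewrite hlo, onebreak_lo by (assumption || lra); reflexivity.
  - rewrite hhi, onebreak_hi by (assumption || lra); reflexivity.
Qed.

Lemma onebreak_lt a b m n x y :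
  ob_ok a b m n -> xv x < xv y -> xv (onebreak a b m n x) < xv (onebreak a b m n y).
Proof.
  intros hok hxy.
  (* The images of the zones lie in the same order as the zones, so monotonicity of [aff] is needed
     only within one zone. *)
  assert (H : forall z, (xv z <= a \/ b <= xv z) /\ xv (onebreak a b m n z) = xv z \/
     (a < xv z <= m /\ xv (onebreak a b m n z) = aff a m a n (xv z) /\
        a < aff a m a n (xv z) <= n) \/
     (m < xv z < b /\ xv (onebreak a b m n z) = aff m b n b (xv z) /\
        n < aff m b n b (xv z) < b)).
  { intros z; pose proof hok as (h0 & hm & hn & h1).
    destruct (Rle_dec (xv z) a); [left; rewrite onebreak_out; lra|].
    destruct (Rle_dec b (xv z)); [left; rewrite onebreak_out; lra|].
    right; destruct (Rle_dec (xv z) m).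
    - left; rewrite onebreak_lo by (assumption || lra).
      pose proof (aff_between_le a m a n (xv z)).
      pose proof (aff_lt a m a n a (xv z)); rewrite aff_l in *.
      repeat split; lra.
    - right; rewrite onebreak_hi by (assumption || lra).
      pose proof (aff_between m b n b (xv z)); repeat split; lra. }
  destruct hok as (h0 & hm & hn & h1).
  pose proof (aff_lt a m a n (xv x) (xv y)).
  pose proof (aff_lt m b n b (xv x) (xv y)).
  destruct (H x) as [(?&?)|[(?&?&?)|(?&?&?)]], (H y) as [(?&?)|[(?&?&?)|(?&?&?)]]; lra.
Qed.

Lemma flip_cases a b x : 0 <= a -> b <= 1 ->
  (a < xv x < b /\ xv (flip a b x) = a + b - xv x) \/
  ((xv x <= a \/ b <= xv x) /\ xv (flip a b x) = xv x).
Proof.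
  intros h0 h1; destruct (Rle_dec (xv x) a); [right; rewrite flip_out; lra|].
  destruct (Rle_dec b (xv x)); [right; rewrite flip_out; lra|].
  left; rewrite flip_in; lra.
Qed.

(** * Identities between flips *)

(** Works from the inside out: a flip applied to a variable becomes a fresh variable with its two
    possible values, which leaves linear arithmetic. *)
Ltac flip_simpl :=
  repeat match goal with
  | |- context [flip ?a ?b ?y] =>
      is_var y;
      let z := fresh "z" in
      let hz := fresh "hz" in
      assert (hz := flip_cases a b y ltac:(lra) ltac:(lra));
      set (z := flip a b y) in *; clearbody z;
      destruct hz as [[? ?]|[? ?]]; try (exfalso; lra)
  end.

(** The reflection of [(m - d, n + d)] exchanges [m] and [n], hence also the intervals of radius
    [r <= d] around them. *)
Lemma flip_conj_small m n r d x :
  0 < r -> r <= d -> d < m -> m < n -> n + d < 1 ->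
  flip (m - d) (n + d) (flip (n - r) (n + r) (flip (m - d) (n + d) x)) =
  flip (m - r) (m + r) x.
Proof.
  intros; apply xv_inj.
  flip_simpl; lra.
Qed.

(** The composite is a commutator of involutions. It exchanges the first quarter with the fourth and
    the second with the third, reversing each three times. *)
Lemma flip_double m r :
  0 < r -> 0 <= m - 2 * r -> m + 2 * r <= 1 ->
  ae_eq (flip (m - 2 * r) (m + 2 * r))
    (fun x => flip (m - r) (m + r)
       (flip (m - 2 * r) m (flip m (m + 2 * r) (flip (m - r) (m + r)
          (flip m (m + 2 * r) (flip (m - 2 * r) m x)))))).
Proof.
  intros h hl hr; exists (m - 2 * r :: m - r :: m :: m + r :: m + 2 * r :: nil).
  intros x hx; simpl in hx.
  assert (xv x <> m - 2 * r /\ xv x <> m - r /\ xv x <> m /\ xv x <> m + r /\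
          xv x <> m + 2 * r) as (? & ? & ? & ? & ?) by (repeat split; intros e; apply hx; rewrite e; tauto).
  apply xv_inj; clear hx.
  assert (xv x < m \/ m < xv x) as [?|?] by lra; flip_simpl; lra.
Qed.

(** * Flips in a nontrivial normal subgroup *)

(** This property passes to composites by its very form, so that products of flips can enter
    commutators. *)
Definition normalizes (H : (X -> X) -> Prop) (g gi : X -> X) : Prop :=
  inverse_of g gi /\
  (forall v, H v -> H (fun x => g (v (gi x)))) /\
  (forall v, H v -> H (fun x => gi (v (g x)))).

Lemma normalizes_comp H g gi h hi :
  normalizes H g gi -> normalizes H h hi ->
  normalizes H (fun x => g (h x)) (fun x => hi (gi x)).
Proof.
  intros (g1 & g2 & g3) (h1 & h2 & h3); split; [apply inverse_comp; assumption|].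
  split; intros v hv.
  - exact (g2 _ (h2 _ hv)).
  - exact (h3 _ (g3 _ hv)).
Qed.

Definition flip_class (G : (X -> X) -> Prop) : Prop :=
  (forall f, G f -> bij f) /\
  (forall f, G f -> exists L : list R, forall x, ~ In (xv x) L -> cont_at f x) /\
  (forall a b, 0 <= a -> a < b -> b <= 1 -> G (flip a b)).

Section NormalSubgroup.
Variables G H : (X -> X) -> Prop.
Hypothesis HG : flip_class G.
Hypothesis HN : quot_normal_subgroup G H.

Lemma H_sub f : H f -> G f.
Proof. apply HN. Qed.

Lemma H_bij f : H f -> bij f.
Proof. intros h; apply HG, H_sub, h. Qed.

Lemma H_id : H (fun x => x).
Proof. apply HN. Qed.

Lemma H_comp f g : H f -> H g -> H (fun x => f (g x)).
Proof. apply HN. Qed.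

Lemma H_inv f g : H f -> inverse_of f g -> H g.
Proof. apply HN. Qed.

Lemma H_ext f g : H f -> (forall x, g x = f x) -> H g.
Proof. intros h e; replace g with f; [exact h|]; extensionality x; auto. Qed.

Lemma H_ae f g : H f -> G g -> ae_eq g f -> H g.
Proof.
  intros hf hg e; destruct HN as (_ & h & _); apply (h f g hf hg).
  apply fin_equiv_of_ae; [apply HG, hg|apply H_bij, hf|exact e].
Qed.

Lemma G_normalizes g gi : G g -> G gi -> inverse_of g gi -> normalizes H g gi.
Proof.
  intros hg hgi hi; destruct HN as (_ & _ & _ & _ & _ & hc).
  split; [exact hi|split; intros v hv].
  - exact (hc v g gi hv hg hi).
  - exact (hc v gi g hv hgi (inverse_sym _ _ hi)).
Qed.

Lemma normalizes_conj_iff g gi f : normalizes H g gi ->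
  H (fun x => g (f (gi x))) -> H f.
Proof.
  intros (h1 & _ & h3) hf; apply (H_ext _ _ (h3 _ hf)).
  destruct h1 as [h1 _]; intros x; rewrite !h1; reflexivity.
Qed.

Lemma flip_normalizes a b : 0 <= a -> a < b -> b <= 1 ->
  normalizes H (flip a b) (flip a b).
Proof.
  intros h0 hab h1; apply G_normalizes; try apply HG; try assumption.
  apply flip_inverse; assumption.
Qed.

(* Writing [u] for the conjugate of [g^-1] by [w], one has [g u] in [H], and
   [h] commutes with [u]; hence [g u] times the inverse of its conjugate by
   [h] is the commutator of [g] and [h]. *)
Lemma commutator_in_H (w wi g gi h hi : X -> X) (U : X -> Prop) :
  H w -> inverse_of w wi -> (forall x, U x -> ~ U (w x)) ->
  normalizes H g gi -> normalizes H h hi ->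
  (forall x, ~ U x -> g x = x) -> (forall x, ~ U x -> h x = x) ->
  H (fun x => g (h (gi (hi x)))).
Proof.
  intros hw iw hU ng nh sg sh.
  destruct ng as (ig & ng1 & ng2), nh as (ih & nh1 & nh2).
  assert (hwi : H wi) by exact (H_inv _ _ hw iw).
  assert (h1 : H (fun x => g (w (gi (wi x))))).
  { apply (H_comp (fun x => g (w (gi x))) wi); [apply ng1|]; assumption. }
  assert (h2 : H (fun x => h (w (g (wi (gi (hi x))))))).
  { apply (nh1 (fun x => w (g (wi (gi x))))).
    apply (H_comp w (fun x => g (wi (gi x)))); [|apply ng1]; assumption. }
  apply (H_ext _ _ (H_comp _ _ h1 h2)); intros x; f_equal.
  destruct iw as [w1 w2], ig as [g1 g2], ih as [i1 i2].
  set (z := gi (hi x)).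
  assert (pres : forall f fi, (forall y, fi (f y) = y) -> (forall y, ~ U y -> f y = y) ->
            forall y, U y -> U (f y)).
  { intros f fi e s y hy; apply NNPP; intros hn.
    assert (e2 : f y = y) by (rewrite <- (e (f y)), (s _ hn), e; reflexivity).
    rewrite e2 in hn; exact (hn hy). }
  assert (sgi : forall y, ~ U y -> gi y = y).
  { intros y hy; rewrite <- (sg y hy) at 1; apply g1. }
  assert (off : forall y, U y -> ~ U (wi y)).
  { intros y hy hn; apply (hU _ hn); rewrite w2; exact hy. }
  (* After applying [w], this says that [u] commutes with [h] at [z]: [u] is the identity on [U],
     because [wi] moves [U] off itself, and [h] is the identity off [U]. *)
  assert (key : gi (wi (h (w (g (wi z))))) = wi (h z)).
  { destruct (classic (U z)) as [hz|hz].
    - rewrite (sg (wi z)) by (apply off, hz); rewrite w2.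
      apply sgi, off, (pres h hi); assumption.
    - rewrite (sh z hz).
      assert (hn : ~ U (w (g (wi z)))).
      { destruct (classic (U (wi z))) as [ht|ht].
        - apply hU, (pres g gi); assumption.
        - rewrite (sg _ ht), w2; exact hz. }
      rewrite (sh _ hn), w1, g1; reflexivity. }
  rewrite key, w2; reflexivity.
Qed.

(** At a continuity point [x] moved by a distance [D], a small ball and its image stay within
    [D / 2] of [x] and of [f x], hence are disjoint. *)
Lemma displaced_interval f :
  H f -> ~ fin_equiv f (fun x => x) ->
  exists m r, 0 < r /\ 0 <= m - r /\ m + r <= 1 /\
    forall x, m - r < xv x < m + r -> ~ (m - r < xv (f x) < m + r).
Proof.
  intros hf hn; destruct (proj1 (proj2 HG) f (H_sub f hf)) as [L hL].
  (* The point [0] is avoided so that a ball around [x] fits into the interval. *)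
  destruct (not_fin_equiv_id_moves f (0 :: L) (H_bij f hf) hn) as (x & hx & hfx).
  assert (hc := hL x (fun i => hx (or_intror i))).
  assert (h0 : xv x <> 0) by (intros e; apply hx; left; auto).
  assert (hne : xv (f x) - xv x <> 0).
  { intros e; apply hfx, xv_inj; lra. }
  assert (hpos := Rabs_pos_lt _ hne).
  set (D := Rabs (xv (f x) - xv x)) in *.
  destruct (hc (D / 2) ltac:(lra)) as (d & hd & hcont).
  pose proof (xv_range x).
  set (r := Rmin (Rmin (xv x) (1 - xv x)) (Rmin d (D / 2))).
  assert (hr : 0 < r) by (unfold r; repeat apply Rmin_pos; lra).
  assert (r <= xv x /\ r <= 1 - xv x /\ r <= d /\ r <= D / 2) as (r1 & r2 & r3 & r4).
  { unfold r; pose proof (Rmin_l (Rmin (xv x) (1 - xv x)) (Rmin d (D / 2))).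
    pose proof (Rmin_r (Rmin (xv x) (1 - xv x)) (Rmin d (D / 2))).
    pose proof (Rmin_l (xv x) (1 - xv x)); pose proof (Rmin_r (xv x) (1 - xv x)).
    pose proof (Rmin_l d (D / 2)); pose proof (Rmin_r d (D / 2)); lra. }
  exists (xv x), r; repeat split; try lra.
  intros y hy hfy.
  assert (hcy : Rabs (xv (f y) - xv (f x)) < D / 2) by (apply hcont, Rabs_def1; lra).
  apply Rabs_def2 in hcy; unfold D, Rabs in *; destruct (Rcase_abs (xv (f x) - xv x)); lra.
Qed.

(** Up to finitely many points, the larger flip is the given one times a conjugate of it. *)
Lemma flip_double_in_H m r :
  0 < r -> 0 <= m - 2 * r -> m + 2 * r <= 1 ->
  H (flip (m - r) (m + r)) -> H (flip (m - 2 * r) (m + 2 * r)).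
Proof.
  intros hr h0 h1 hf.
  apply (H_ae _ _) with (3 := flip_double m r hr h0 h1); [|apply HG; lra].
  apply (H_comp (flip (m - r) (m + r))); [exact hf|].
  destruct (normalizes_comp H _ _ _ _ (flip_normalizes (m - 2 * r) m h0 ltac:(lra) ltac:(lra))
              (flip_normalizes m (m + 2 * r) ltac:(lra) ltac:(lra) h1)) as (_ & hc & _).
  exact (hc _ hf).
Qed.

Lemma flips_in_H f :
  H f -> ~ fin_equiv f (fun x => x) ->
  forall a b, 0 <= a -> a < b -> b <= 1 -> H (flip a b).
Proof.
  intros hf hn; destruct (displaced_interval f hf hn) as (m & r & hr & h0 & h1 & hU).
  destruct (H_bij f hf) as [fi hfi].
  (* The flips whose commutator is the flip of radius [s] around [m] are supported in the displaced
     interval. *)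
  assert (base : forall s, 0 < s -> 2 * s <= r -> H (flip (m - s) (m + s))).
  { intros s hs hsr; set (t := s / 2); replace s with (2 * t) by (unfold t; lra).
    assert (0 < t) by (unfold t; lra); assert (4 * t <= r) by (unfold t; lra).
    refine (H_ae _ _ _ _ (flip_double m t _ _ _)); try (apply HG); try lra.
    refine (commutator_in_H f fi (flip (m - t) (m + t)) (flip (m - t) (m + t))
             (fun x => flip (m - 2 * t) m (flip m (m + 2 * t) x))
             (fun x => flip m (m + 2 * t) (flip (m - 2 * t) m x))
             (fun x => m - r < xv x < m + r) hf hfi hU _ _ _ _).
    - apply flip_normalizes; lra.
    - apply normalizes_comp; apply flip_normalizes; lra.
    - intros x hx; apply flip_out; lra.
    - intros x hx; rewrite (flip_out m) by lra; apply flip_out; lra. }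
  (* Conjugation by the flip of an interval containing both centres carries [m] to [n]; [d] is small
     enough to keep that interval inside [(0, 1)]. *)
  assert (small : forall n, 0 < n < 1 ->
            exists e, 0 < e /\ forall s, 0 < s -> s <= e -> H (flip (n - s) (n + s))).
  { intros n hn01.
    set (d := Rmin (Rmin m (1 - m)) (Rmin n (1 - n)) / 2).
    assert (0 < d) by (unfold d; apply Rdiv_lt_0_compat; [repeat apply Rmin_pos|]; lra).
    assert (2 * d <= m /\ 2 * d <= 1 - m /\ 2 * d <= n /\ 2 * d <= 1 - n) as (? & ? & ? & ?).
    { unfold d; pose proof (Rmin_l (Rmin m (1 - m)) (Rmin n (1 - n))).
      pose proof (Rmin_r (Rmin m (1 - m)) (Rmin n (1 - n))).
      pose proof (Rmin_l m (1 - m)); pose proof (Rmin_r m (1 - m)).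
      pose proof (Rmin_l n (1 - n)); pose proof (Rmin_r n (1 - n)); lra. }
    exists (Rmin (r / 2) d); split; [apply Rmin_pos; lra|]; intros s hs hse.
    pose proof (Rmin_l (r / 2) d); pose proof (Rmin_r (r / 2) d).
    assert (hb := base s hs ltac:(lra)).
    destruct (Rtotal_order n m) as [lt|[->|gt]]; [|exact hb|].
    - destruct (flip_normalizes (n - d) (m + d)) as (_ & hc & _); try lra.
      apply (H_ext _ _ (hc _ hb)); intros x; symmetry; apply flip_conj_small; lra.
    - destruct (flip_normalizes (m - d) (n + d)) as (_ & hc & _); try lra.
      apply (H_ext _ _ (hc _ hb)); intros x; apply xv_inj; flip_simpl; lra. }
  assert (all : forall n e, 0 < e -> (forall s, 0 < s -> s <= e -> H (flip (n - s) (n + s))) ->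
            forall k s, 0 < s -> s <= 2 ^ k * e -> 0 <= n - s -> n + s <= 1 ->
              H (flip (n - s) (n + s))).
  { intros n e he hs k; induction k as [|k IH]; simpl; intros s hs0 hse hl hu.
    - apply hs; lra.
    - replace s with (2 * (s / 2)) by lra; apply flip_double_in_H; try lra.
      apply IH; lra. }
  intros a b ha hab hb.
  replace (flip a b) with (flip ((a + b) / 2 - (b - a) / 2) ((a + b) / 2 + (b - a) / 2))
    by (f_equal; lra).
  destruct (small ((a + b) / 2) ltac:(lra)) as (e & he & hsm).
  (* The power [2 ^ k] is at least [/ e], so [k] doublings reach every radius. *)
  destruct (Pow_x_infinity 2 ltac:(rewrite Rabs_right; lra) (/ e)) as [k hk].
  apply (all _ e he hsm k); try lra.
  specialize (hk k (le_n k)); rewrite Rabs_right in hk by (apply Rle_ge, pow_le; lra).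
  apply Rge_le in hk; apply (Rmult_le_compat_r e) in hk; [|lra].
  rewrite Rinv_l in hk; lra.
Qed.

End NormalSubgroup.

(** * Subdivisions of the interval *)

(** A subdivision as the list of right ends of its pieces, each piece subject to [Q]; this form
    suits inductions that peel off the first piece. *)
Fixpoint chain (Q : R -> R -> Prop) (c : R) (l : list R) (d : R) : Prop :=
  match l with
  | nil => c = d
  | e :: l' => c < e /\ Q c e /\ chain Q e l' d
  end.

Lemma chain_le Q l c d : chain Q c l d -> c <= d.
Proof.
  revert c; induction l as [|e l IH]; simpl; intros c h; [lra|].
  destruct h as (h1 & _ & h2); apply IH in h2; lra.
Qed.

Lemma chain_impl (Q Q' : R -> R -> Prop) l c d :
  (forall u v, c <= u -> u < v -> v <= d -> Q u v -> Q' u v) ->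
  chain Q c l d -> chain Q' c l d.
Proof.
  revert c; induction l as [|e l IH]; simpl; intros c hQ h; [exact h|].
  destruct h as (h1 & h2 & h3); assert (hle := chain_le _ _ _ _ h3).
  split; [exact h1|split; [apply hQ; lra || exact h2|]].
  apply IH; [|exact h3]; intros u v hu hv hd; apply hQ; lra.
Qed.

Lemma chain_app Q l l' c d e : chain Q c l d -> chain Q d l' e -> chain Q c (l ++ l') e.
Proof.
  revert c; induction l as [|u l IH]; simpl; intros c h h'; [rewrite h; exact h'|].
  destruct h as (h1 & h2 & h3); auto.
Qed.

Lemma chain_avoiding (L : list R) c d :
  c <= d -> exists l, chain (fun u v => forall z, u < z < v -> ~ In z L) c l d.
Proof.
  revert c d; induction L as [|r L IH]; intros c d hcd.
  - destruct (Req_dec c d) as [e|e]; [exists nil; exact e|].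
    exists (d :: nil); simpl; repeat split; [lra|tauto].
  - destruct (Rlt_dec c r) as [h1|h1]; [destruct (Rlt_dec r d) as [h2|h2]|].
    1: { destruct (IH c r ltac:(lra)) as [l hl], (IH r d ltac:(lra)) as [l' hl'].
      exists (l ++ l'); apply (chain_app _ _ _ _ r).
      - revert hl; apply chain_impl; intros u v hu huv hv hQ z hz [e|i]; [lra|].
        exact (hQ z hz i).
      - revert hl'; apply chain_impl; intros u v hu huv hv hQ z hz [e|i]; [lra|].
        exact (hQ z hz i). }
    all: destruct (IH c d hcd) as [l hl]; exists l; revert hl; apply chain_impl.
    all: intros u v hu huv hv hQ z hz [e|i]; [lra|exact (hQ z hz i)].
Qed.

Lemma chain_of_partition Q n (a : nat -> R) :
  (forall i, (i < n)%nat -> a i < a (S i)) ->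
  (forall i, (i < n)%nat -> Q (a i) (a (S i))) ->
  exists l, chain Q (a 0%nat) l (a n).
Proof.
  revert a; induction n as [|n IH]; intros a h1 h2; [exists nil; reflexivity|].
  destruct (IH (fun i => a (S i))) as [l hl].
  - intros i hi; apply h1; lia.
  - intros i hi; apply h2; lia.
  - exists (a 1%nat :: l); simpl; split; [apply h1; lia|split; [apply h2; lia|exact hl]].
Qed.

Lemma partition_of_chain Q l c d :
  chain Q c l d ->
  exists n (a : nat -> R), a 0%nat = c /\ a n = d /\
    (forall i, (i < n)%nat -> a i < a (S i)) /\
    (forall i, (i < n)%nat -> Q (a i) (a (S i))).
Proof.
  revert c; induction l as [|e l IH]; simpl; intros c h.
  - exists 0%nat, (fun _ => c); repeat split; [exact h|lia|lia].
  - destruct h as (h1 & h2 & h3); destruct (IH e h3) as (n & a & a0 & an & ha & hQ).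
    exists (S n), (fun i => match i with O => c | S j => a j end).
    repeat split; [exact an| |]; intros [|i] hi; try rewrite a0; try assumption.
    + apply ha; lia.
    + apply hQ; lia.
Qed.

Lemma chain_cover Q l c d (x : R) :
  chain Q c l d -> c < x < d -> ~ In x l ->
  exists u v, c <= u /\ v <= d /\ u < x < v /\ Q u v.
Proof.
  revert c; induction l as [|e l IH]; simpl; intros c h hx hn; [lra|].
  destruct h as (h1 & h2 & h3); assert (hle := chain_le _ _ _ _ h3).
  destruct (Rtotal_order x e) as [lt|[eq|gt]].
  - exists c, e; repeat split; lra || assumption.
  - exfalso; apply hn; left; auto.
  - destruct (IH e h3 ltac:(lra) ltac:(tauto)) as (u & v & ? & ? & ? & ?).
    exists u, v; repeat split; lra || assumption.
Qed.

(** * Membership in the two groups *)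

Lemma PAff_chain f : in_PAff_hat f -> exists l, chain (affine_on f) 0 l 1.
Proof.
  intros (_ & n & a & a0 & an & ha & hf).
  rewrite <- a0, <- an; apply chain_of_partition; assumption.
Qed.

(** The possible breaks come as an unordered list, and [chain_avoiding] turns them into a
    partition. *)
Lemma PAff_of_affine_off f (L : list R) :
  bij f ->
  (forall u v, 0 <= u -> u < v -> v <= 1 -> (forall z, u < z < v -> ~ In z L) ->
     affine_on f u v) ->
  in_PAff_hat f.
Proof.
  intros hb hL; split; [exact hb|].
  destruct (chain_avoiding L 0 1 ltac:(lra)) as [l hl].
  apply (partition_of_chain (affine_on f) l 0 1).
  revert hl; apply chain_impl; intros u v h0 huv h1 hz; apply hL; assumption.
Qed.

Lemma affine_on_cont f u v x : affine_on f u v -> u < xv x < v -> cont_at f x.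
Proof.
  intros (m & c & h) hx eps heps.
  assert (hm : 0 < Rabs m + 1) by (pose proof (Rabs_pos m); lra).
  assert (hd : 0 < eps / (Rabs m + 1)) by (apply Rdiv_lt_0_compat; lra).
  exists (Rmin (Rmin (xv x - u) (v - xv x)) (eps / (Rabs m + 1))); split.
  - repeat apply Rmin_pos; lra.
  - intros y hy.
    pose proof (Rmin_l (Rmin (xv x - u) (v - xv x)) (eps / (Rabs m + 1))).
    pose proof (Rmin_r (Rmin (xv x - u) (v - xv x)) (eps / (Rabs m + 1))).
    pose proof (Rmin_l (xv x - u) (v - xv x)); pose proof (Rmin_r (xv x - u) (v - xv x)).
    assert (hy' : Rabs (xv y - xv x) < eps / (Rabs m + 1)) by lra.
    assert (hyb : Rabs (xv y - xv x) < Rmin (xv x - u) (v - xv x)) by lra.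
    apply Rabs_def2 in hyb.
    rewrite !h by lra; replace (m * xv y + c - (m * xv x + c)) with (m * (xv y - xv x)) by ring.
    rewrite Rabs_mult; apply (Rmult_lt_compat_r (Rabs m + 1)) in hy'; [|exact hm].
    unfold Rdiv in hy'; rewrite Rmult_assoc, Rinv_l in hy' by lra.
    pose proof (Rabs_pos (xv y - xv x)); lra.
Qed.

Lemma PAff_cont f :
  in_PAff_hat f -> exists L : list R, forall x, ~ In (xv x) L -> cont_at f x.
Proof.
  intros hf; destruct (PAff_chain f hf) as [l hl].
  exists (0 :: l); simpl; intros x hx; pose proof (xv_range x).
  assert (xv x <> 0) by (intros e; apply hx; left; auto).
  destruct (chain_cover _ _ _ _ (xv x) hl ltac:(lra) ltac:(tauto)) as (u & v & _ & _ & h1 & h2).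
  exact (affine_on_cont f u v x h2 h1).
Qed.

Lemma PC_of_cont_off f (L : list R) :
  bij f -> (forall x, ~ In (xv x) L -> cont_at f x) -> in_PC_hat f.
Proof.
  intros hb hL; split; [exact hb|]; exists (map toX L); intros x hx.
  apply hL; intros hin; apply hx, in_map_iff; exists (xv x).
  split; [apply toX_xv|exact hin].
Qed.

Lemma PC_cont f :
  in_PC_hat f -> exists L : list R, forall x, ~ In (xv x) L -> cont_at f x.
Proof.
  intros [_ [F hF]]; exists (map xv F); intros x hx; apply hF.
  intros hin; apply hx, in_map; exact hin.
Qed.

Lemma PAff_sub_PC f : in_PAff_hat f -> in_PC_hat f.
Proof.
  intros hf; destruct (PAff_cont f hf) as [L hL]; exact (PC_of_cont_off f L (proj1 hf) hL).
Qed.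

Lemma flip_PAff a b : 0 <= a -> a < b -> b <= 1 -> in_PAff_hat (flip a b).
Proof.
  intros h0 hab h1; apply (PAff_of_affine_off _ (a :: b :: nil)).
  - exists (flip a b); apply flip_inverse; assumption.
  - intros u v hu huv hv hz.
    assert (ha : ~ (u < a < v)) by (intros h; apply (hz a h); simpl; auto).
    assert (hb : ~ (u < b < v)) by (intros h; apply (hz b h); simpl; auto).
    assert ((v <= a \/ b <= u) \/ (a <= u /\ v <= b)) as [h|h] by lra.
    + apply affine_on_id; intros x hx; apply flip_out; lra.
    + exists (-1), (a + b); intros x hx; rewrite flip_in; lra.
Qed.

Lemma onebreak_PAff a b m n : ob_ok a b m n -> in_PAff_hat (onebreak a b m n).
Proof.
  intros hok; apply (PAff_of_affine_off _ (a :: m :: b :: nil)).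
  - exists (onebreak a b n m); apply onebreak_inverse; assumption.
  - intros u v hu huv hv hz.
    assert (ha : ~ (u < a < v)) by (intros h; apply (hz a h); simpl; auto).
    assert (hm : ~ (u < m < v)) by (intros h; apply (hz m h); simpl; auto).
    assert (hb : ~ (u < b < v)) by (intros h; apply (hz b h); simpl; auto).
    assert ((v <= a \/ b <= u) \/ (a <= u /\ v <= m) \/ (m <= u /\ v <= b))
      as [h|[h|h]] by (destruct hok; lra).
    + apply affine_on_id; intros x hx; apply onebreak_out; lra.
    + apply (affine_on_aff _ _ _ a m a n); intros x hx; apply onebreak_lo; lra || assumption.
    + apply (affine_on_aff _ _ _ m b n b); intros x hx; apply onebreak_hi; lra || assumption.
Qed.

Definition increasing (f : X -> X) : Prop := forall x y, xv x < xv y -> xv (f x) < xv (f y).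

(** Surjectivity excludes jumps: the preimages of [f x - eps] and [f x + eps] bound a neighbourhood
    of [x]. If such a value leaves [[0, 1)], the range of [f] gives the bound on that side. *)
Lemma increasing_cont f x : bij f -> increasing f -> cont_at f x.
Proof.
  intros [fi [h1 h2]] hinc eps heps.
  assert (refl : forall y z, xv (f y) < xv (f z) -> xv y < xv z).
  { intros y z h; destruct (Rtotal_order (xv y) (xv z)) as [l|[e|g]]; [exact l| |].
    - apply xv_inj in e; subst; lra.
    - apply hinc in g; lra. }
  assert (low : exists d, 0 < d /\ forall y, xv x - d < xv y -> xv (f x) - eps < xv (f y)).
  { destruct (Rlt_dec (xv (f x) - eps) 0) as [h|h].
    - exists 1; split; [lra|]; intros y _; pose proof (xv_range (f y)); lra.
    - pose proof (xv_range (f x)).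
      set (z := fi (toX (xv (f x) - eps))).
      assert (hz : xv (f z) = xv (f x) - eps) by (unfold z; rewrite h2, xv_toX; lra).
      assert (xv z < xv x) by (apply refl; lra).
      exists (xv x - xv z); split; [lra|]; intros y hy.
      rewrite <- hz; apply hinc; lra. }
  assert (up : exists d, 0 < d /\ forall y, xv y < xv x + d -> xv (f y) < xv (f x) + eps).
  { destruct (Rlt_dec (xv (f x) + eps) 1) as [h|h].
    - pose proof (xv_range (f x)).
      set (z := fi (toX (xv (f x) + eps))).
      assert (hz : xv (f z) = xv (f x) + eps) by (unfold z; rewrite h2, xv_toX; lra).
      assert (xv x < xv z) by (apply refl; lra).
      exists (xv z - xv x); split; [lra|]; intros y hy.
      rewrite <- hz; apply hinc; lra.
    - exists 1; split; [lra|]; intros y _; pose proof (xv_range (f y)); lra. }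
  destruct low as (d1 & p1 & q1), up as (d2 & p2 & q2).
  exists (Rmin d1 d2); split; [apply Rmin_pos; assumption|]; intros y hy.
  pose proof (Rmin_l d1 d2); pose proof (Rmin_r d1 d2); apply Rabs_def2 in hy.
  specialize (q1 y ltac:(lra)); specialize (q2 y ltac:(lra)); apply Rabs_def1; lra.
Qed.

Lemma increasing_PC f : bij f -> increasing f -> in_PC_hat f.
Proof.
  intros hb hi; split; [exact hb|]; exists nil; intros x _; apply increasing_cont; assumption.
Qed.

Lemma increasing_inv f fi : inverse_of f fi -> increasing f -> increasing fi.
Proof.
  intros [h1 h2] h x y hxy.
  destruct (Rtotal_order (xv (fi x)) (xv (fi y))) as [l|[e|g]]; [exact l| |].
  - apply xv_inj in e; assert (x = y) by (rewrite <- (h2 x), e; apply h2); subst; lra.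
  - apply h in g; rewrite !h2 in g; lra.
Qed.

Lemma increasing_comp f g : increasing f -> increasing g -> increasing (fun x => f (g x)).
Proof. intros hf hg x y h; apply hf, hg, h. Qed.

Lemma onebreak_increasing a b m n : ob_ok a b m n -> increasing (onebreak a b m n).
Proof. intros h x y; apply onebreak_lt, h. Qed.

Lemma flip_class_PC : flip_class in_PC_hat.
Proof.
  split; [intros f hf; apply hf|split; [exact PC_cont|]].
  intros a b h0 hab h1; apply PAff_sub_PC, flip_PAff; assumption.
Qed.

Lemma flip_class_PAff : flip_class in_PAff_hat.
Proof. split; [intros f hf; apply hf|split; [exact PAff_cont|exact flip_PAff]]. Qed.

(** * Reduction to the identity, piece by piece *)

Definition monotone_on (s : bool) (f : X -> X) (a b : R) : Prop :=
  forall x y, a < xv x < b -> a < xv y < b -> xv x < xv y ->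
    if s then xv (f x) < xv (f y) else xv (f y) < xv (f x).

(* [f] maps [(a, b)] monotonically onto [(p, q)], preserving the orientation
   when [s] is [true] and reversing it when [s] is [false]. *)
Definition maps_onto (s : bool) (f : X -> X) (a b p q : R) : Prop :=
  p < q /\
  (forall x, a < xv x < b -> p < xv (f x) < q) /\
  (forall z, p < z < q -> exists x, a < xv x < b /\ xv (f x) = z) /\
  monotone_on s f a b.

(** The composite preserves the order exactly when both orientations agree, which is what [Bool.eqb]
    computes. *)
Lemma maps_onto_comp s t f g a b p q p' q' :
  maps_onto s f a b p q -> maps_onto t g p q p' q' ->
  maps_onto (Bool.eqb t s) (fun x => g (f x)) a b p' q'.
Proof.
  intros (f1 & f2 & f3 & f4) (g1 & g2 & g3 & g4).
  split; [exact g1|split; [|split]].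
  - intros x hx; apply g2, f2, hx.
  - intros z hz; destruct (g3 z hz) as (y & hy & <-).
    destruct (f3 (xv y) hy) as (x & hx & e); apply xv_inj in e; subst.
    exists x; split; [exact hx|reflexivity].
  - intros x y hx hy hxy; assert (h := f4 x y hx hy hxy).
    assert (h1 := f2 x hx); assert (h2 := f2 y hy).
    destruct s, t; simpl; (apply (g4 (f x) (f y)) + apply (g4 (f y) (f x))); assumption.
Qed.

Lemma maps_onto_aff g p q p' q' :
  0 <= p -> p < q -> q <= 1 -> p' < q' ->
  (forall x, p < xv x < q -> xv (g x) = aff p q p' q' (xv x)) ->
  maps_onto true g p q p' q'.
Proof.
  intros h0 hpq h1 hpq' hg; split; [exact hpq'|split; [|split]].
  - intros x hx; rewrite hg by exact hx; apply aff_between; assumption.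
  - intros z hz; assert (hb := aff_between p' q' p q z hz hpq).
    exists (toX (aff p' q' p q z)); rewrite xv_toX by lra; split; [exact hb|].
    rewrite hg; rewrite xv_toX by lra; [apply aff_inv; lra|exact hb].
  - intros x y hx hy hxy; rewrite !hg by assumption; apply aff_lt; assumption.
Qed.

Lemma maps_onto_aff_rev g p q p' q' :
  0 <= p -> p < q -> q <= 1 -> p' < q' ->
  (forall x, p < xv x < q -> xv (g x) = aff p q q' p' (xv x)) ->
  maps_onto false g p q p' q'.
Proof.
  intros h0 hpq h1 hpq' hg.
  assert (neg : forall x, aff p q q' p' x = p' + q' - aff p q p' q' x).
  { intros x; unfold aff; field; lra. }
  split; [exact hpq'|split; [|split]].
  - intros x hx; rewrite hg, neg by exact hx.
    pose proof (aff_between p q p' q' (xv x) hx hpq'); lra.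
  - intros z hz; assert (hb := aff_between p' q' p q (p' + q' - z) ltac:(lra) hpq).
    exists (toX (aff p' q' p q (p' + q' - z))); rewrite xv_toX by lra; split; [exact hb|].
    rewrite hg; rewrite xv_toX by lra; [|exact hb].
    rewrite neg, aff_inv; lra.
  - intros x y hx hy hxy; simpl; rewrite !hg, !neg by assumption.
    pose proof (aff_lt p q p' q' (xv x) (xv y) hpq hpq' hxy); lra.
Qed.

Lemma maps_onto_id g p q :
  0 <= p -> p < q -> q <= 1 -> (forall x, p < xv x < q -> g x = x) -> maps_onto true g p q p q.
Proof.
  intros h0 h h1 hg; apply maps_onto_aff; try assumption.
  intros x hx; rewrite hg, aff_id by lra; reflexivity.
Qed.

Lemma maps_onto_flip u v p q :
  0 <= u -> v <= 1 -> u <= p -> p < q -> q <= v ->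
  maps_onto false (flip u v) p q (u + v - q) (u + v - p).
Proof.
  intros; apply maps_onto_aff_rev; try lra.
  intros x hx; rewrite flip_in by lra; unfold aff; field; lra.
Qed.

(** For [q = 1], which is not a point of [X], the value at the right end is replaced by [1];
    surjectivity makes this the right end of the image. *)
Lemma maps_onto_increasing g p q :
  bij g -> increasing g -> 0 <= p -> p < q -> q <= 1 ->
  maps_onto true g p q (xv (g (toX p))) (if Rlt_dec q 1 then xv (g (toX q)) else 1).
Proof.
  intros [gi hgi] hg h0 hpq h1.
  assert (hgi' := increasing_inv _ _ hgi hg).
  assert (ep : xv (toX p) = p) by (apply xv_toX; lra).
  assert (up : forall x, p < xv x < q ->
            xv (g x) < (if Rlt_dec q 1 then xv (g (toX q)) else 1)).
  { intros x hx; destruct (Rlt_dec q 1); [|apply xv_range].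
    apply hg; rewrite xv_toX; lra. }
  assert (lo : forall x, p < xv x < q -> xv (g (toX p)) < xv (g x)).
  { intros x hx; apply hg; lra. }
  split; [|split; [|split]].
  - assert (hm : xv (toX ((p + q) / 2)) = (p + q) / 2) by (apply xv_toX; lra).
    specialize (up (toX ((p + q) / 2)) ltac:(lra)).
    specialize (lo (toX ((p + q) / 2)) ltac:(lra)); lra.
  - intros x hx; split; [apply lo|apply up]; exact hx.
  - intros z hz; destruct hgi as [i1 i2].
    assert (hz1 : z < 1).
    { destruct (Rlt_dec q 1); [pose proof (xv_range (g (toX q)))|]; lra. }
    pose proof (xv_range (g (toX p))).
    assert (ez : xv (toX z) = z) by (apply xv_toX; lra).
    exists (gi (toX z)); split; [|rewrite i2; exact ez].
    split.
    + rewrite <- ep, <- (i1 (toX p)); apply hgi'; lra.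
    + destruct (Rlt_dec q 1); [|pose proof (xv_range (gi (toX z))); lra].
      rewrite <- (xv_toX q) by lra; rewrite <- (i1 (toX q)); apply hgi'; lra.
  - intros x y _ _ hxy; apply hg, hxy.
Qed.

(** Overlapping images would share a value with two preimages. *)
Lemma maps_onto_disjoint s t f a b p q a' b' p' q' :
  bij f -> maps_onto s f a b p q -> maps_onto t f a' b' p' q' -> b <= a' ->
  q' <= p \/ q <= p'.
Proof.
  intros [fi hf] (f1 & _ & f2 & _) (g1 & _ & g2 & _) hba.
  destruct (Rle_dec q' p) as [|n1]; [left; assumption|].
  destruct (Rle_dec q p') as [|n2]; [right; assumption|exfalso].
  set (l := Rmax p p'); set (r := Rmin q q').
  assert (l < r) by (unfold l, r, Rmax, Rmin; destruct (Rle_dec p p'), (Rle_dec q q'); lra).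
  assert (p <= l /\ p' <= l /\ r <= q /\ r <= q') as (? & ? & ? & ?)
    by (unfold l, r; auto using Rmax_l, Rmax_r, Rmin_l, Rmin_r).
  destruct (f2 ((l + r) / 2) ltac:(lra)) as (x & hx & ex).
  destruct (g2 ((l + r) / 2) ltac:(lra)) as (y & hy & ey).
  assert (x = y) by (apply (inverse_inj f fi _ _ hf), xv_inj; lra).
  subst; lra.
Qed.

Definition fixes_below (f : X -> X) (c : R) : Prop :=
  exists L : list R, forall x, xv x < c -> ~ In (xv x) L -> f x = x.

(** All but finitely many values below [c] are taken at fixed points below [c], so by injectivity a
    piece beyond [c] cannot reach them. *)
Lemma maps_onto_ge s f c a b p q :
  bij f -> fixes_below f c -> c <= a -> maps_onto s f a b p q -> c <= p.
Proof.
  intros [fi hf] [L hL] hca (f1 & _ & f2 & _); destruct (Rle_dec c p); [assumption|exfalso].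
  destruct (exists_avoiding L p (Rmin c q) ltac:(apply Rmin_glb_lt; lra)) as (z & hz & hzL).
  pose proof (Rmin_l c q); pose proof (Rmin_r c q).
  destruct (f2 z ltac:(lra)) as (x & hx & <-).
  assert (e : f (f x) = f x) by (apply hL; [lra|exact hzL]).
  apply (inverse_inj f fi _ _ hf) in e; rewrite e in *; lra.
Qed.

Lemma maps_onto_le s f a b p q : maps_onto s f a b p q -> q <= 1.
Proof.
  intros (h & _ & h2 & _); destruct (Rle_dec q 1); [assumption|exfalso].
  pose proof (Rmax_l p 1); pose proof (Rmax_r p 1).
  assert (Rmax p 1 < q) by (apply Rmax_lub_lt; lra).
  destruct (h2 ((Rmax p 1 + q) / 2) ltac:(lra)) as (x & _ & e).
  pose proof (xv_range x); pose proof (xv_range (f x)); lra.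
Qed.

(* The regularity required from the pieces: none for the piecewise continuous
   maps, affineness for the piecewise affine ones. *)
Definition affine_stable (C : (X -> X) -> R -> R -> Prop) : Prop :=
  forall s f g a b p q, C f a b -> maps_onto s f a b p q -> affine_on g p q ->
    C (fun x => g (f x)) a b.

Definition piece (C : (X -> X) -> R -> R -> Prop) (f : X -> X) (a b : R) : Prop :=
  C f a b /\ exists s p q, maps_onto s f a b p q.

Definition piece_above (C : (X -> X) -> R -> R -> Prop) (y : R) (f : X -> X) (a b : R) : Prop :=
  C f a b /\ exists s p q, maps_onto s f a b p q /\ y <= p.

(** The last hypothesis says that the flip does not cut the image: it reverses it as a whole or
    leaves it alone. *)
Lemma piece_flip C f s a b p q u v :
  affine_stable C -> C f a b -> maps_onto s f a b p q ->
  0 <= u -> u < v -> v <= 1 -> 0 <= p -> q <= u \/ (u <= p /\ q <= v) \/ v <= p ->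
  piece C (fun x => flip u v (f x)) a b.
Proof.
  intros hC hf ho h0 huv h1 hp h.
  assert (hq := maps_onto_le _ _ _ _ _ _ ho); assert (hpq := proj1 ho).
  assert ((q <= u \/ v <= p) \/ (u <= p /\ q <= v)) as [h'|h'] by lra.
  - assert (hid : forall x, p < xv x < q -> flip u v x = x)
      by (intros x hx; apply flip_out; lra).
    split; [apply (hC s f _ a b p q); auto using affine_on_id|].
    exists (Bool.eqb true s), p, q; eapply maps_onto_comp; [exact ho|apply maps_onto_id; assumption].
  - split.
    + apply (hC s f _ a b p q); auto.
      exists (-1), (u + v); intros x hx; rewrite flip_in; lra.
    + do 3 eexists; eapply maps_onto_comp; [exact ho|apply maps_onto_flip; lra].
Qed.

Lemma fixes_below_comp f g c :
  fixes_below f c -> (forall x, xv x < c -> g x = x) -> fixes_below (fun x => g (f x)) c.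
Proof.
  intros [L hL] hg; exists L; intros x h1 h2; rewrite hL by assumption; apply hg, h1.
Qed.

(** This is the step where the two groups differ. The equivalence of [d = 1] and [y = 1] is what
    allows a homeomorphism of [(c, 1)] to carry [(c, y)] onto [(c, d)]. *)
Definition straightens (H : (X -> X) -> Prop) (C : (X -> X) -> R -> R -> Prop) : Prop :=
  forall f c d y l, bij f -> 0 <= c -> c < d -> c < y -> d <= 1 -> y <= 1 -> (d = 1 <-> y = 1) ->
    C f c d -> maps_onto true f c d c y -> chain (piece_above C y f) d l 1 ->
    exists g, H g /\ (forall x, xv x < c -> g x = x) /\
      (forall x, c < xv x < d -> g (f x) = x) /\
      chain (piece C (fun x => g (f x))) d l 1.

Section Reduction.
Variable H : (X -> X) -> Prop.
Variable C : (X -> X) -> R -> R -> Prop.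
Hypothesis HC : affine_stable C.
Hypothesis Hid : H (fun x => x).
Hypothesis Hcomp : forall f g, H f -> H g -> H (fun x => f (g x)).
Hypothesis Hbij : forall f, H f -> bij f.
Hypothesis Hflip : forall a b, 0 <= a -> a < b -> b <= 1 -> H (flip a b).
Hypothesis Hstr : straightens H C.

(* The flip of the image of the first piece adjusts the orientation; the flip
   of everything between [c] and the end of this image then moves the image to
   [c]. The images of the other pieces are never cut. *)
Lemma move_first_piece f c d l :
  bij f -> 0 <= c -> c < d -> fixes_below f c -> piece C f c d -> chain (piece C f) d l 1 ->
  exists h y, H h /\ (forall x, xv x < c -> h x = x) /\
    C (fun x => h (f x)) c d /\ maps_onto true (fun x => h (f x)) c d c y /\
    chain (piece C (fun x => h (f x))) d l 1.
Proof.
  intros hb h0 hcd hfix (hC & s & p & q & ho) hl.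
  (* The first piece is made order reversing, because the second flip reverses it once more. *)
  assert (rev : exists h1, H h1 /\ (forall x, xv x < c -> h1 x = x) /\
            C (fun x => h1 (f x)) c d /\ maps_onto false (fun x => h1 (f x)) c d p q /\
            chain (piece C (fun x => h1 (f x))) d l 1).
  { assert (hp := maps_onto_ge _ _ _ _ _ _ _ hb hfix (Rle_refl c) ho).
    assert (hq := maps_onto_le _ _ _ _ _ _ ho); assert (hpq := proj1 ho).
    destruct s; [|exists (fun x => x); exact (conj Hid (conj (fun x _ => eq_refl) (conj hC (conj ho hl))))].
    exists (flip p q); split; [apply Hflip; lra|].
    split; [intros x hx; apply flip_out; lra|].
    assert (hm := maps_onto_flip p q p q ltac:(lra) ltac:(lra) ltac:(lra) ltac:(lra) ltac:(lra)).
    replace (p + q - q) with p in hm by ring; replace (p + q - p) with q in hm by ring.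
    split; [|split].
    - apply (HC true f _ c d p q); auto.
      exists (-1), (p + q); intros x hx; rewrite flip_in; lra.
    - exact (maps_onto_comp _ _ _ _ _ _ _ _ _ _ ho hm).
    - revert hl; apply chain_impl; intros u v hu huv hv (hC' & t & p' & q' & ho').
      apply (piece_flip C f t u v p' q'); auto; try lra.
      + pose proof (maps_onto_ge _ _ c u _ _ _ hb hfix ltac:(lra) ho'); lra.
      + destruct (maps_onto_disjoint _ _ _ _ _ _ _ _ _ _ _ hb ho ho' hu); auto. }
  destruct rev as (h1 & hh1 & hfix1 & hC1 & ho1 & hl1).
  assert (hb1 : bij (fun x => h1 (f x))) by (apply bij_comp; auto).
  assert (hfixb := fixes_below_comp f h1 c hfix hfix1).
  assert (hp := maps_onto_ge _ _ _ _ _ _ _ hb1 hfixb (Rle_refl c) ho1).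
  assert (hq := maps_onto_le _ _ _ _ _ _ ho1); assert (hpq := proj1 ho1).
  (* The flip of [(c, q)] sends [p] to [c + q - p], the right end of the new image. *)
  exists (fun x => flip c q (h1 x)), (c + q - p).
  split; [apply Hcomp; [apply Hflip; lra|exact hh1]|].
  split; [intros x hx; rewrite hfix1 by exact hx; apply flip_out; lra|].
  split; [|split].
  - apply (HC false (fun x => h1 (f x)) _ c d p q); auto.
    exists (-1), (c + q); intros x hx; rewrite flip_in; lra.
  - assert (hm := maps_onto_flip c q p q h0 ltac:(lra) hp hpq ltac:(lra)).
    replace (c + q - q) with c in hm by ring.
    exact (maps_onto_comp _ _ _ _ _ _ _ _ _ _ ho1 hm).
  - revert hl1; apply chain_impl; intros u v hu huv hv (hC' & t & p' & q' & ho').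
    assert (hp' := maps_onto_ge _ _ c u _ _ _ hb1 hfixb ltac:(lra) ho').
    apply (piece_flip C (fun x => h1 (f x)) t u v p' q'); auto; try lra.
    destruct (maps_onto_disjoint _ _ _ _ _ _ _ _ _ _ _ hb1 ho1 ho' hu); auto.
    right; left; lra.
Qed.

(** If [d = 1] and [y < 1], values in [(y, 1)] could be taken at finitely many points only. If
    [y = 1] and [d < 1], the image of the next piece would lie above [1]. *)
Lemma first_piece_end f c d y l :
  bij f -> c < d -> fixes_below f c -> maps_onto true f c d c y ->
  chain (piece_above C y f) d l 1 -> (d = 1 <-> y = 1).
Proof.
  intros [fi [f1 f2]] hcd [L hL] hm hl.
  assert (hy := maps_onto_le _ _ _ _ _ _ hm); destruct hm as (hcy & ho & _); split; intros e.
  - destruct (Req_dec y 1) as [|n]; [assumption|exfalso].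
    destruct (exists_avoiding (map (fun r => xv (f (toX r))) (c :: L)) y 1 ltac:(lra))
      as (z & hz & hzL).
    destruct (Rle_dec 0 y) as [hy0|hy0].
    2: { specialize (ho (toX ((Rmax 0 c + d) / 2))).
         pose proof (Rmax_l 0 c); pose proof (Rmax_r 0 c).
         assert (Rmax 0 c < d) by (apply Rmax_lub_lt; lra).
         rewrite xv_toX in ho by lra; specialize (ho ltac:(lra)).
         pose proof (xv_range (f (toX ((Rmax 0 c + d) / 2)))); lra. }
    set (x := fi (toX z)); assert (ex : xv (f x) = z) by (unfold x; rewrite f2; apply xv_toX; lra).
    assert (hin : ~ In (xv x) (c :: L)).
    { intros i; apply hzL, in_map_iff; exists (xv x); rewrite toX_xv; split; assumption. }
    simpl in hin; pose proof (xv_range x).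
    destruct (Rtotal_order (xv x) c) as [lt|[eq|gt]]; [|apply hin; left; auto|].
    + rewrite hL in ex by tauto; lra.
    + specialize (ho x ltac:(lra)); lra.
  - destruct l as [|u l]; simpl in hl; [exact hl|exfalso].
    destruct hl as (_ & (_ & s & p & q & hm & hp) & _).
    pose proof (maps_onto_le _ _ _ _ _ _ hm); pose proof (proj1 hm); lra.
Qed.

(** Each round of the induction makes the first remaining piece the identity and adds its left end
    to the exceptional points. *)
Lemma reduction l : forall f c,
  bij f -> 0 <= c -> fixes_below f c -> chain (piece C f) c l 1 ->
  exists h, H h /\ ae_eq (fun x => h (f x)) (fun x => x).
Proof.
  induction l as [|d l IH]; simpl; intros f c hb h0 hfix hl.
  - exists (fun x => x); split; [exact Hid|]; destruct hfix as [L hL]; exists L; intros x hx.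
    pose proof (xv_range x); apply hL; [lra|exact hx].
  - destruct hl as (hcd & hp & hl).
    assert (hd1 := chain_le _ _ _ _ hl).
    destruct (move_first_piece f c d l hb h0 hcd hfix hp hl)
      as (h1 & y & hh1 & hfix1 & hC1 & ho1 & hl1).
    assert (hb1 : bij (fun x => h1 (f x))) by (apply bij_comp; auto).
    assert (hfixb := fixes_below_comp f h1 c hfix hfix1).
    assert (hy1 := maps_onto_le _ _ _ _ _ _ ho1).
    assert (hl2 : chain (piece_above C y (fun x => h1 (f x))) d l 1).
    { revert hl1; apply chain_impl; intros u v hu huv hv (hC' & t & p & q & ho).
      split; [exact hC'|exists t, p, q; split; [exact ho|]].
      assert (hp' := maps_onto_ge _ _ c u _ _ _ hb1 hfixb ltac:(lra) ho).
      destruct (maps_onto_disjoint _ _ _ _ _ _ _ _ _ _ _ hb1 ho1 ho hu); [|lra].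
      pose proof (proj1 ho); lra. }
    destruct (Hstr (fun x => h1 (f x)) c d y l hb1 h0 hcd (proj1 ho1) hd1 hy1
                (first_piece_end _ _ _ _ _ hb1 hcd hfixb ho1 hl2) hC1 ho1 hl2)
      as (g & hg & hgfix & hgd & hgl).
    destruct (IH (fun x => g (h1 (f x))) d) as (h & hh & hae).
    + apply (bij_comp g); auto.
    + lra.
    + destruct (fixes_below_comp _ _ _ hfixb hgfix) as [L hL].
      exists (c :: L); simpl; intros x hx hn.
      destruct (Rtotal_order (xv x) c) as [lt|[eq|gt]]; [|exfalso; auto|].
      * apply hL; tauto.
      * apply hgd; lra.
    + exact hgl.
    + exists (fun x => h (g (h1 x))); split; [|exact hae].
      apply (Hcomp h (fun x => g (h1 x))); auto.
Qed.

End Reduction.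

(** The reduction gives [h] in [H] with [h f] equal to the identity off a finite set, so there [f]
    agrees with the inverse of [h]. *)
Lemma quot_simple_of_straightens G (C : (X -> X) -> R -> R -> Prop) :
  flip_class G -> affine_stable C ->
  (forall f, G f -> exists l, chain (piece C f) 0 l 1) ->
  (forall H, quot_normal_subgroup G H ->
     (forall a b, 0 <= a -> a < b -> b <= 1 -> H (flip a b)) -> straightens H C) ->
  quot_simple G.
Proof.
  intros HG HC hpiece hstr; split.
  - exists (flip 0 1); split; [apply HG; lra|intros he].
    (* The only fixed points of [flip 0 1] are [0] and [1 / 2]. *)
    destruct (fin_equiv_id_fixes _ 0 (1 / 2) he) as (x & hx & e); try lra.
    apply (f_equal xv) in e; rewrite flip_in in e; lra.
  - intros H HN.
    destruct (classic (forall f, H f -> fin_equiv f (fun x => x))) as [|hno]; [left; assumption|].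
    right; apply not_all_ex_not in hno; destruct hno as [f0 hno]; apply imply_to_and in hno.
    destruct hno as [hf0 hno]; intros f hf.
    assert (Hflip := flips_in_H G H HG HN f0 hf0 hno).
    destruct (hpiece f hf) as [l hl].
    destruct (reduction H C HC (H_id G H HN) (H_comp G H HN) (H_bij G H HG HN) Hflip
                (hstr H HN Hflip) l f 0) as (h & hh & L & hL).
    + apply HG, hf.
    + lra.
    + exists nil; intros x hx; pose proof (xv_range x); lra.
    + exact hl.
    + destruct (H_bij G H HG HN h hh) as [hi hhi].
      apply (H_ae G H HG HN hi f); [exact (H_inv G H HN h hi hh hhi)|exact hf|].
      exists L; intros x hx; rewrite <- (hL x hx) at 2; symmetry; apply hhi.
Qed.

(** * Conjugates and commutators of one-break homeomorphisms *)

(** Only the restriction of [k] to the support matters: it rescales [(a, b)] to [(a', b')], and with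
    it the break and its image. *)
Lemma onebreak_conj k ki a b m n a' b' x :
  ob_ok a b m n -> inverse_of k ki -> 0 <= a' -> a' < b' -> b' <= 1 ->
  (forall x, a < xv x < b -> xv (k x) = aff a b a' b' (xv x)) ->
  k (onebreak a b m n (ki x)) =
  onebreak a' b' (aff a b a' b' m) (aff a b a' b' n) x.
Proof.
  intros hok [k1 k2] h0 hab h1 hk; pose proof hok as (a0 & hm & hn & b1).
  assert (hm' := aff_between a b a' b' m hm hab).
  assert (hn' := aff_between a b a' b' n hn hab).
  (* By injectivity of [k] the affine preimage is the only one. *)
  assert (hki : forall y, a' < xv y < b' -> xv (ki y) = aff a' b' a b (xv y)).
  { intros y hy; assert (hb := aff_between a' b' a b (xv y) hy ltac:(lra)).
    assert (e : k (toX (aff a' b' a b (xv y))) = y).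
    { apply xv_inj; rewrite hk; rewrite xv_toX by lra; [apply aff_inv; lra|exact hb]. }
    rewrite <- e, k1, xv_toX by lra; rewrite e; reflexivity. }
  set (m' := aff a b a' b' m) in *; set (n' := aff a b a' b' n) in *.
  assert (em : aff a' b' a b m' = m) by (unfold m'; apply aff_inv; lra).
  revert x; apply onebreak_unique; [repeat split; lra| | |].
  - intros y hy; rewrite onebreak_out; [apply k2|].
    destruct (Rle_dec (xv (ki y)) a); [left; assumption|].
    destruct (Rle_dec b (xv (ki y))); [right; assumption|exfalso].
    assert (e := hk (ki y) ltac:(lra)); rewrite k2 in e.
    pose proof (aff_between a b a' b' (xv (ki y))); lra.
  - intros y hy; assert (e := hki y ltac:(lra)).
    rewrite <- (aff_restrict a' b' a b a' m'), aff_l, em in e by lra.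
    pose proof (aff_between_le a' m' a m (xv y)).
    pose proof (aff_lt a' m' a m a' (xv y)); rewrite aff_l in *.
    assert (e2 := onebreak_lo a b m n (ki y) hok ltac:(lra)).
    rewrite e, aff_aff in e2 by lra.
    pose proof (aff_between_le a' m' a n (xv y)).
    pose proof (aff_lt a' m' a n a' (xv y)); rewrite aff_l in *.
    rewrite hk by lra; rewrite e2.
    rewrite <- (aff_restrict a b a' b' a n), aff_l by lra; fold n'; apply aff_aff; lra.
  - intros y hy; assert (e := hki y ltac:(lra)).
    rewrite <- (aff_restrict a' b' a b m' b'), aff_r, em in e by lra.
    pose proof (aff_between m' b' m b (xv y)).
    assert (e2 := onebreak_hi a b m n (ki y) hok ltac:(lra)).
    rewrite e, aff_aff in e2 by lra.
    pose proof (aff_between m' b' n b (xv y)).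
    rewrite hk by lra; rewrite e2.
    rewrite <- (aff_restrict a b a' b' n b), aff_r by lra; fold n'; apply aff_aff; lra.
Qed.

Lemma onebreak_conj_flip u v a b m n x :
  ob_ok a b m n -> 0 <= u -> u <= a -> b <= v -> v <= 1 ->
  flip u v (onebreak a b m n (flip u v x)) =
  onebreak (u + v - b) (u + v - a) (u + v - m) (u + v - n) x.
Proof.
  intros hok h0 hu hv h1; pose proof hok as (a0 & hm & hn & b1).
  revert x; apply onebreak_unique; [repeat split; lra| | |]; intros y hy.
  - rewrite onebreak_out; [apply flip_invol; lra|].
    destruct (flip_cases u v y); lra.
  - assert (e := flip_in u v y h0 h1 ltac:(lra)).
    assert (e2 := onebreak_hi a b m n (flip u v y) hok ltac:(lra)); rewrite e in e2.
    pose proof (aff_between_le m b n b (u + v - xv y)).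
    assert (aff m b n b (u + v - xv y) < b).
    { pose proof (aff_lt m b n b (u + v - xv y) b); rewrite (aff_r m b) in *; lra. }
    rewrite flip_in by lra; rewrite e2; unfold aff; field; lra.
  - assert (e := flip_in u v y h0 h1 ltac:(lra)).
    assert (e2 := onebreak_lo a b m n (flip u v y) hok ltac:(lra)); rewrite e in e2.
    pose proof (aff_between a m a n (u + v - xv y)).
    rewrite flip_in by lra; rewrite e2; unfold aff; field; lra.
Qed.

Lemma onebreak_comp a b m n k x :
  ob_ok a b m n -> ob_ok a b n k ->
  onebreak a b n k (onebreak a b m n x) = onebreak a b m k x.
Proof.
  intros h1 h2; pose proof h1 as (a0 & hm & hn & b1).
  pose proof h2 as (_ & _ & hk & _).
  revert x; apply onebreak_unique; [repeat split; lra| | |]; intros y hy.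
  - rewrite (onebreak_out a b m n), onebreak_out by lra; reflexivity.
  - assert (e := onebreak_lo a b m n y h1 ltac:(lra)).
    pose proof (aff_between_le a m a n (xv y)).
    rewrite onebreak_lo by (assumption || lra); rewrite e; apply aff_aff; lra.
  - assert (e := onebreak_hi a b m n y h1 ltac:(lra)).
    pose proof (aff_between m b n b (xv y)).
    rewrite onebreak_hi by (assumption || lra); rewrite e; apply aff_aff; lra.
Qed.

(* [s] scales [(p, q)] onto [(p, A)] while fixing [p], so near [p] the map
   [F = onebreak p q A B] and its conjugate by [s] coincide. What is left of
   [F] times the inverse of this conjugate is again a map with one break, of
   different ratios. *)
Lemma onebreak_commutator p q u A B x :
  0 <= p -> p < A < q -> p < B < q -> q < u -> u <= 1 ->
  onebreak p q A B (onebreak p u q A (onebreak p q B A (onebreak p u A q x))) =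
  onebreak (aff p q p A B) q A B x.
Proof.
  intros hp hA hB hq hu.
  (* The three inner maps form the conjugate of the inverse of [F] by [s], a one-break map supported
     in [(p, A)]. *)
  rewrite (onebreak_conj (onebreak p u q A) (onebreak p u A q) p q B A p A);
    try lra; [|repeat split; lra|apply onebreak_inverse; repeat split; lra|].
  2: { intros y hy; apply onebreak_lo; [repeat split|]; lra. }
  set (c := aff p q p A B); set (e := aff p q p A A).
  assert (hc := aff_between p q p A B hB ltac:(lra)); fold c in hc.
  assert (he := aff_between p q p A A hA ltac:(lra)); fold e in he.
  (* On [(p, c)] the conjugate ends at [e], and [F] takes [e] back to [c]; so the two cancel
     there. *)
  assert (ece : aff p A p B e = c) by (unfold c, e, aff; field; lra).
  assert (ok1 : ob_ok p A c e) by (repeat split; lra).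
  assert (ok2 : ob_ok p q A B) by (repeat split; lra).
  assert (hcB : c < B).
  { pose proof (aff_lt p A p B e A); rewrite ece, aff_r in *; lra. }
  revert x; apply onebreak_unique; [repeat split; lra| | |]; intros y hy.
  - destruct (Rle_dec (xv y) p); [rewrite (onebreak_out p A), onebreak_out by lra; reflexivity|].
    destruct (Rle_dec q (xv y)); [rewrite (onebreak_out p A), onebreak_out by lra; reflexivity|].
    assert (f := onebreak_lo p A c e y ok1 ltac:(lra)).
    pose proof (aff_between_le p c p e (xv y)).
    apply xv_inj; rewrite onebreak_lo by (assumption || lra); rewrite f.
    rewrite <- (aff_restrict p A p B p e), aff_l, ece by lra; apply aff_inv; lra.
  - assert (f := onebreak_hi p A c e y ok1 ltac:(lra)).
    pose proof (aff_between_le c A e A (xv y)).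
    rewrite onebreak_lo by (assumption || lra); rewrite f.
    rewrite <- (aff_restrict p A p B e A), aff_r, ece by lra; apply aff_aff; lra.
  - rewrite (onebreak_out p A) by lra; apply onebreak_hi; assumption || lra.
Qed.

(** * One-break homeomorphisms in the normal subgroup *)

Section OneBreaks.
Variables G H : (X -> X) -> Prop.
Hypothesis HG : flip_class G.
Hypothesis Gob : forall a b m n, ob_ok a b m n -> G (onebreak a b m n).
Hypothesis HN : quot_normal_subgroup G H.
Hypothesis Hflip : forall a b, 0 <= a -> a < b -> b <= 1 -> H (flip a b).

Lemma onebreak_normalizes a b m n :
  ob_ok a b m n -> normalizes H (onebreak a b m n) (onebreak a b n m).
Proof.
  intros h; apply (G_normalizes G H HN).
  - apply Gob, h.
  - apply Gob, ob_ok_sym, h.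
  - apply onebreak_inverse, h.
Qed.

(** The flip of [(0, 1)] lies in [H] and moves [(1 / 2, 1)] off itself. *)
Lemma commutator_right_half_in_H g gi h hi :
  normalizes H g gi -> normalizes H h hi ->
  (forall x, xv x <= 1 / 2 -> g x = x) -> (forall x, xv x <= 1 / 2 -> h x = x) ->
  H (fun x => g (h (gi (hi x)))).
Proof.
  intros ng nh sg sh.
  apply (commutator_in_H G H HN (flip 0 1) (flip 0 1) g gi h hi (fun x => 1 / 2 < xv x));
    try assumption.
  - apply Hflip; lra.
  - apply flip_inverse; lra.
  - intros x hx hfx; pose proof (xv_range x); destruct (flip_cases 0 1 x); lra.
  - intros x hx; apply sg; lra.
  - intros x hx; apply sh; lra.
Qed.

Lemma onebreak_right_in_H_aux c A B :
  0 < c -> c < A < 1 -> c < B < 1 -> 1 + c < A + B -> H (onebreak c 1 A B).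
Proof.
  intros hc hA hB hAB.
  (* The commutator below has, after a reflection, the slopes [(1 - b) / (1 - a)] and
     [b (1 - a) / (a (1 - b))]. This choice makes them the slopes [(B - c) / (A - c)] and
     [(1 - B) / (1 - A)] of the target; the inequality on [A + B] says that [a] and [b] are below
     [1]. *)
  set (a := (1 - A) / (B - c)); set (b := (1 - B) / (A - c)).
  assert (ea : a * (B - c) = 1 - A) by (unfold a; field; lra).
  assert (eb : b * (A - c) = 1 - B) by (unfold b; field; lra).
  assert (ha : 0 < a < 1).
  { split; [apply Rdiv_lt_0_compat; lra|].
    apply (Rmult_lt_reg_r (B - c)); lra. }
  assert (hb : 0 < b < 1).
  { split; [apply Rdiv_lt_0_compat; lra|].
    apply (Rmult_lt_reg_r (A - c)); lra. }
  assert (hab : 0 < a * b < 1) by nra.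
  set (c0 := 1 / 2 + a * b / 4).
  assert (ec0 : aff (1 / 2) (3 / 4) (1 / 2) (1 / 2 + a / 4) (1 / 2 + b / 4) = c0)
    by (unfold aff, c0; field).
  assert (h1 : H (onebreak c0 (3 / 4) (1 / 2 + a / 4) (1 / 2 + b / 4))).
  { refine (H_ext H _ _ (commutator_right_half_in_H
      (onebreak (1 / 2) (3 / 4) (1 / 2 + a / 4) (1 / 2 + b / 4))
      (onebreak (1 / 2) (3 / 4) (1 / 2 + b / 4) (1 / 2 + a / 4))
      (onebreak (1 / 2) 1 (3 / 4) (1 / 2 + a / 4))
      (onebreak (1 / 2) 1 (1 / 2 + a / 4) (3 / 4)) _ _ _ _) _).
    1, 2: apply onebreak_normalizes; repeat split; lra.
    1, 2: intros x hx; apply onebreak_out; lra.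
    intros x; rewrite onebreak_commutator, ec0 by lra; reflexivity. }
  assert (c0A : c0 < 1 / 2 + a / 4) by (unfold c0; nra).
  assert (c0B : c0 < 1 / 2 + b / 4) by (unfold c0; nra).
  (* Reflecting [(c0, 1)] moves the support to [(c1, 1)] and exchanges the two slopes. *)
  set (c1 := c0 + 1 / 4).
  assert (h2 : H (onebreak c1 1 (c0 + 1 - (1 / 2 + a / 4)) (c0 + 1 - (1 / 2 + b / 4)))).
  { destruct (flip_normalizes G H HG HN c0 1) as (_ & hn & _); try (unfold c0; lra).
    apply (H_ext H _ _ (hn _ h1)); intros x; symmetry.
    rewrite onebreak_conj_flip by (try (repeat split); unfold c0 in *; lra).
    f_equal; unfold c1; lra. }
  (* This conjugator rescales [(c1, 1)] to [(c, 1)]. *)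
  destruct (onebreak_normalizes 0 1 c1 c) as (hi & hn & _); [unfold c1, c0; repeat split; lra|].
  apply (H_ext H _ _ (hn _ h2)); intros x; symmetry.
  rewrite (onebreak_conj _ _ _ _ _ _ c 1) with (2 := hi).
  - assert (hne : (B - c) * (A - c) - (1 - A) * (1 - B) <> 0).
    { replace ((B - c) * (A - c) - (1 - A) * (1 - B))
        with ((1 - c) * (A + B - 1 - c)) by ring.
      apply Rmult_integral_contrapositive; lra. }
    assert (hne' : 1 - a * b <> 0) by lra.
    f_equal; unfold aff, c1, c0.
    + transitivity (c + (1 - a) * (1 - c) / (1 - a * b)); [field; lra|].
      unfold a, b; field; repeat split; lra.
    + transitivity (c + (1 - b) * (1 - c) / (1 - a * b)); [field; lra|].
      unfold a, b; field; repeat split; lra.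
  - unfold c1, c0 in *; repeat split; lra.
  - lra.
  - lra.
  - lra.
  - intros y hy; apply onebreak_hi; [unfold c1, c0; repeat split; lra|lra].
Qed.

(** Passing from [A] to [B] through a point [W] close to [1] makes both factors satisfy the
    inequality of the auxiliary lemma. *)
Lemma onebreak_right_in_H c A B :
  0 < c -> c < A < 1 -> c < B < 1 -> H (onebreak c 1 A B).
Proof.
  intros hc hA hB.
  set (W := 1 - (Rmin A B - c) / 2).
  pose proof (Rmin_l A B); pose proof (Rmin_r A B).
  assert (c < Rmin A B) by (apply Rmin_glb_lt; lra).
  refine (H_ext H _ _ (H_comp G H HN (onebreak c 1 W B) (onebreak c 1 A W) _ _) _).
  1, 2: apply onebreak_right_in_H_aux; unfold W; lra.
  intros x; symmetry; apply onebreak_comp; unfold W; repeat split; lra.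
Qed.

Lemma onebreak_left_in_H z A B :
  z < 1 -> 0 < A < z -> 0 < B < z -> H (onebreak 0 z A B).
Proof.
  intros hz hA hB.
  destruct (flip_normalizes G H HG HN 0 1) as (_ & hn & _); try lra.
  apply (H_ext H _ _ (hn _ (onebreak_right_in_H (1 - z) (1 - A) (1 - B) ltac:(lra)
                               ltac:(lra) ltac:(lra)))).
  intros x; symmetry; rewrite onebreak_conj_flip by (try (repeat split); lra).
  f_equal; lra.
Qed.

(** For [c = 0] the map is a product of one-break maps supported in [(0, z)] and in [(A, 1)]. *)
Lemma onebreak_in_H c A B : 0 <= c -> c < A < 1 -> c < B < 1 -> H (onebreak c 1 A B).
Proof.
  intros hc hA hB; destruct (Req_dec c 0) as [->|]; [|apply onebreak_right_in_H; lra].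
  set (z := (Rmax A B + 1) / 2).
  pose proof (Rmax_l A B); pose proof (Rmax_r A B).
  assert (Rmax A B < 1) by (apply Rmax_lub_lt; lra).
  (* The map [onebreak 0 1 A B] sends [z0] to [z]; the break of the inner factor at [z0] cancels
     that of the outer factor at [z]. *)
  set (z0 := aff B 1 A 1 z).
  assert (hz0 : A < z0 < 1) by (apply aff_between; unfold z; lra).
  assert (ez : aff A 1 B 1 z0 = z) by (apply aff_inv; lra).
  assert (hz : A < z /\ B < z /\ z < 1) by (unfold z; lra).
  refine (H_ext H _ _ (H_comp G H HN (onebreak 0 z A B) (onebreak A 1 z0 z) _ _) _).
  - apply onebreak_left_in_H; lra.
  - apply onebreak_right_in_H; lra.
  - assert (ok1 : ob_ok 0 z A B) by (repeat split; lra).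
    assert (ok2 : ob_ok A 1 z0 z) by (repeat split; lra).
    intros x; symmetry; revert x; apply onebreak_unique; [repeat split; lra| | |]; intros y hy.
    + pose proof (xv_range y); rewrite (onebreak_out A 1), onebreak_out by lra; reflexivity.
    + rewrite (onebreak_out A 1) by lra; apply onebreak_lo; [assumption|lra].
    + destruct (Rle_dec (xv y) z0).
      * assert (e := onebreak_lo A 1 z0 z y ok2 ltac:(lra)).
        pose proof (aff_between_le A z0 A z (xv y)).
        rewrite onebreak_hi by (assumption || lra); rewrite e, aff_aff by lra.
        rewrite <- (aff_restrict A 1 B 1 A z0), aff_l, ez by lra; reflexivity.
      * assert (e := onebreak_hi A 1 z0 z y ok2 ltac:(lra)).
        pose proof (aff_between z0 1 z 1 (xv y)).
        rewrite onebreak_out by lra; rewrite e.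
        rewrite <- (aff_restrict A 1 B 1 z0 1), aff_r, ez by lra; reflexivity.
Qed.

End OneBreaks.

(** * Simplicity of the piecewise affine group *)

Lemma affine_on_stable : affine_stable affine_on.
Proof.
  intros s f g a b p q (m & c & hf) (_ & ho & _) (m' & c' & hg).
  exists (m' * m), (m' * c + c'); intros x hx; rewrite hg by (apply ho, hx).
  rewrite hf by exact hx; ring.
Qed.

Lemma affine_on_endpoints f u v m c x :
  u < v -> xv (f x) = m * xv x + c -> xv (f x) = aff u v (m * u + c) (m * v + c) (xv x).
Proof. intros huv ->; unfold aff; field; lra. Qed.

Lemma PAff_pieces f : in_PAff_hat f -> exists l, chain (piece affine_on f) 0 l 1.
Proof.
  intros hf; destruct (PAff_chain f hf) as [l hl]; exists l; revert hl; apply chain_impl.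
  intros u v hu huv hv hfa; split; [exact hfa|]; destruct hfa as (m & c & h).
  destruct (Rtotal_order m 0) as [lt|[eq|gt]].
  - exists false, (m * v + c), (m * u + c); apply maps_onto_aff_rev; try lra; [nra|].
    intros x hx; apply affine_on_endpoints; [exact huv|apply h, hx].
  - exfalso; destruct hf as [[fi hfi] _].
    assert (e : toX ((2 * u + v) / 3) = toX ((u + 2 * v) / 3)).
    { apply (inverse_inj f fi _ _ hfi), xv_inj.
      rewrite !h by (rewrite xv_toX by lra; lra); rewrite eq; ring. }
    apply (f_equal xv) in e; rewrite !xv_toX in e; lra.
  - exists true, (m * u + c), (m * v + c); apply maps_onto_aff; try lra; [nra|].
    intros x hx; apply affine_on_endpoints; [exact huv|apply h, hx].
Qed.

Lemma maps_onto_unique s t f a b p q p' q' :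
  maps_onto s f a b p q -> maps_onto t f a b p' q' -> p = p' /\ q = q'.
Proof.
  assert (half : forall s t p q p' q', maps_onto s f a b p q -> maps_onto t f a b p' q' ->
            p <= p' /\ q' <= q).
  { clear; intros s t p q p' q' (hpq & f1 & _) (hpq' & _ & f2 & _).
    pose proof (Rmin_l p q'); pose proof (Rmin_r p q').
    pose proof (Rmax_l q p'); pose proof (Rmax_r q p').
    split; [destruct (Rle_dec p p') as [|n]|destruct (Rle_dec q' q) as [|n]];
      try assumption; exfalso.
    - assert (p' < Rmin p q') by (apply Rmin_glb_lt; lra).
      destruct (f2 ((p' + Rmin p q') / 2) ltac:(lra)) as (x & hx & e).
      specialize (f1 x hx); lra.
    - assert (Rmax q p' < q') by (apply Rmax_lub_lt; lra).
      destruct (f2 ((q' + Rmax q p') / 2) ltac:(lra)) as (x & hx & e).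
      specialize (f1 x hx); lra. }
  intros h1 h2; destruct (half _ _ _ _ _ _ h1 h2), (half _ _ _ _ _ _ h2 h1); lra.
Qed.

(** Monotonicity makes the slope positive, so the affine formula takes the ends of the piece to the
    ends [p] and [q] of its image. *)
Lemma affine_maps_onto f a b p q x :
  0 <= a -> a < b -> b <= 1 -> affine_on f a b -> maps_onto true f a b p q ->
  a < xv x < b -> xv (f x) = aff a b p q (xv x).
Proof.
  intros h0 hab h1 (m & c & hf) hm hx.
  assert (hm0 : 0 < m).
  { destruct hm as (_ & _ & _ & hmon).
    specialize (hmon (toX ((2 * a + b) / 3)) (toX ((a + 2 * b) / 3))); simpl in hmon.
    rewrite !hf in hmon by (rewrite xv_toX by lra; lra); rewrite !xv_toX in hmon by lra.
    specialize (hmon ltac:(lra) ltac:(lra) ltac:(lra)); nra. }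
  assert (hm' : maps_onto true f a b (m * a + c) (m * b + c)).
  { apply maps_onto_aff; try lra; [nra|].
    intros y hy; apply affine_on_endpoints; [exact hab|apply hf, hy]. }
  destruct (maps_onto_unique _ _ _ _ _ _ _ _ _ hm hm') as [-> ->].
  apply affine_on_endpoints; [exact hab|apply hf, hx].
Qed.

(** The piece is [aff c d c y], undone by the one-break map of [(c, 1)] taking [y] to [d]. If
    [d = 1], the piece is already the identity. *)
Lemma PAff_straightens H :
  quot_normal_subgroup in_PAff_hat H ->
  (forall a b, 0 <= a -> a < b -> b <= 1 -> H (flip a b)) ->
  straightens H affine_on.
Proof.
  intros HN Hflip f c d y l hb h0 hcd hcy hd hy hend hC hm hl.
  assert (hf := fun x => affine_maps_onto f c d c y x h0 hcd hd hC hm).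
  destruct (Req_dec d 1) as [e|e].
  - exists (fun x => x); split; [apply (H_id _ _ HN)|split; [reflexivity|split]].
    + intros x hx; apply xv_inj; rewrite hf, (proj1 hend e), e by exact hx; apply aff_id; lra.
    + revert hl; apply chain_impl; intros u v _ _ _ (h1 & s & p & q & h2 & _).
      split; [exact h1|exists s, p, q; exact h2].
  - assert (hy1 : y < 1) by (destruct (Req_dec y 1); [exfalso; tauto|lra]).
    assert (hok : ob_ok c 1 y d) by (repeat split; lra).
    exists (onebreak c 1 y d); split; [|split; [|split]].
    + apply (onebreak_in_H in_PAff_hat H flip_class_PAff onebreak_PAff HN Hflip); lra.
    + intros x hx; apply onebreak_out; lra.
    + intros x hx; assert (hr := proj1 (proj2 hm) x hx).
      apply xv_inj; rewrite onebreak_lo by (assumption || lra).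
      rewrite hf by exact hx; apply aff_inv; lra.
    + revert hl; apply chain_impl; intros u v _ _ _ (h1 & s & p & q & h2 & h3).
      assert (hq := maps_onto_le _ _ _ _ _ _ h2); assert (hpq := proj1 h2); split.
      * apply (affine_on_stable s f (onebreak c 1 y d) u v p q h1 h2).
        apply (affine_on_aff _ _ _ y 1 d 1); intros x hx.
        apply onebreak_hi; [exact hok|lra].
      * do 3 eexists; eapply maps_onto_comp; [exact h2|apply maps_onto_increasing; try lra].
        -- exists (onebreak c 1 d y); apply onebreak_inverse, hok.
        -- apply onebreak_increasing, hok.
Qed.

Lemma PAff_simple : quot_simple in_PAff_hat.
Proof.
  exact (quot_simple_of_straightens _ affine_on flip_class_PAff affine_on_stable
           PAff_pieces PAff_straightens).
Qed.

(** * Increasing homeomorphisms *)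

(** Meant to extend an increasing bijection [phi] of [(c, y)] onto [(c, d)] to all of [X]; the
    affine part absorbs the displacement of the right end. *)
Definition patch (phi : X -> X) (c y d z : R) (x : X) : X :=
  if Rle_dec (xv x) c then x
  else if Rlt_dec (xv x) y then phi x
  else if Rlt_dec (xv x) z then toX (aff y z d z (xv x))
  else x.

(** The equivalence makes the affine part empty at the source exactly when it is empty at the
    target. *)
Definition patch_ok (phi : X -> X) (c y d z : R) : Prop :=
  0 <= c /\ c < y <= z /\ c < d <= z /\ z <= 1 /\ (y = z <-> d = z) /\
  forall x, c < xv x < y -> c < xv (phi x) < d.

Lemma patch_cases phi c y d z x :
  patch_ok phi c y d z ->
  (xv x <= c /\ patch phi c y d z x = x) \/
  (c < xv x < y /\ c < xv (phi x) < d /\ patch phi c y d z x = phi x) \/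
  (y <= xv x < z /\ d < z /\ d <= aff y z d z (xv x) < z /\
     xv (patch phi c y d z x) = aff y z d z (xv x)) \/
  (z <= xv x /\ patch phi c y d z x = x).
Proof.
  intros (h0 & hy & hd & h1 & hyd & hphi); unfold patch.
  destruct (Rle_dec (xv x) c) as [a1|a1]; [left; auto|right].
  destruct (Rlt_dec (xv x) y) as [a2|a2].
  { left; split; [lra|split; [apply hphi; lra|reflexivity]]. }
  right; destruct (Rlt_dec (xv x) z) as [a3|a3]; [left|right; split; [lra|reflexivity]].
  assert (d < z) by (destruct (Req_dec d z) as [e|e]; [apply hyd in e|]; lra).
  pose proof (aff_between_le y z d z (xv x)).
  pose proof (aff_lt y z d z (xv x) z); rewrite (aff_r y z) in * by lra.
  rewrite xv_toX; repeat split; lra.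
Qed.

Lemma patch_cancel phi phi' c y d z x :
  patch_ok phi c y d z -> patch_ok phi' c d y z ->
  (forall x, c < xv x < y -> phi' (phi x) = x) ->
  patch phi' c d y z (patch phi c y d z x) = x.
Proof.
  intros h1 h2 hc; pose proof h1 as (_ & hy & hd & _).
  destruct (patch_cases phi c y d z x h1) as [(a1 & e)|[(a1 & a2 & e)|[(a1 & a2 & a3 & e)|(a1 & e)]]].
  - rewrite e; destruct (patch_cases phi' c d y z x h2) as [(_ & e')|[?|[?|?]]]; try exact e'; lra.
  - rewrite e; destruct (patch_cases phi' c d y z (phi x) h2)
      as [?|[(_ & _ & e')|[?|?]]]; try lra; rewrite e'; apply hc, a1.
  - apply xv_inj; destruct (patch_cases phi' c d y z (patch phi c y d z x) h2)
      as [?|[?|[(_ & _ & _ & e')|?]]]; try lra; rewrite e', e; apply aff_inv; lra.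
  - rewrite e; destruct (patch_cases phi' c d y z x h2) as [?|[?|[?|(_ & e')]]]; try exact e'; lra.
Qed.

Lemma patch_increasing phi c y d z :
  patch_ok phi c y d z ->
  (forall u v, c < xv u < y -> c < xv v < y -> xv u < xv v -> xv (phi u) < xv (phi v)) ->
  increasing (patch phi c y d z).
Proof.
  intros h hphi u v huv; pose proof h as (_ & hy & hd & _).
  pose proof (aff_lt y z d z (xv u) (xv v)).
  specialize (hphi u v).
  destruct (patch_cases phi c y d z u h) as [(a1 & e)|[(a1 & a2 & e)|[(a1 & a2 & a3 & e)|(a1 & e)]]];
  destruct (patch_cases phi c y d z v h) as [(b1 & e')|[(b1 & b2 & e')|[(b1 & b2 & b3 & e')|(b1 & e')]]];
  rewrite e, e'; lra.
Qed.

Lemma increasing_zero f x : bij f -> increasing f -> xv x = 0 -> f x = x.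
Proof.
  intros [fi [f1 f2]] hf hx.
  destruct (Rtotal_order (xv (fi x)) (xv x)) as [lt|[e|gt]].
  - pose proof (xv_range (fi x)); lra.
  - apply xv_inj in e; rewrite <- e at 1; apply f2.
  - apply hf in gt; rewrite f2 in gt; pose proof (xv_range (f x)); lra.
Qed.

(** The two reversals cancel on [(u, v)], which [f] preserves because it fixes all points
    outside. *)
Lemma increasing_conj_flip f u v :
  bij f -> increasing f -> 0 <= u -> u < v -> v <= 1 ->
  (forall x, xv x <= u \/ v <= xv x -> f x = x) ->
  increasing (fun x => flip u v (f (flip u v x))).
Proof.
  intros hb hf h0 huv h1 hfix.
  assert (pres : forall x, u < xv x < v -> u < xv (f x) < v).
  { intros x hx; split.
    - assert (e : f (toX u) = toX u) by (apply hfix; rewrite xv_toX; lra).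
      apply (f_equal xv) in e; rewrite xv_toX in e by lra.
      rewrite <- e; apply hf; rewrite xv_toX; lra.
    - destruct (Req_dec v 1) as [->|]; [apply xv_range|].
      assert (e : f (toX v) = toX v) by (apply hfix; rewrite xv_toX; lra).
      apply (f_equal xv) in e; rewrite xv_toX in e by lra.
      rewrite <- e; apply hf; rewrite xv_toX; lra. }
  assert (cases : forall x,
    (u < xv x < v /\ xv (flip u v x) = u + v - xv x /\
     u < xv (flip u v (f (flip u v x))) < v /\
     xv (flip u v (f (flip u v x))) = u + v - xv (f (flip u v x))) \/
    ((xv x <= u \/ v <= xv x) /\ flip u v (f (flip u v x)) = x)).
  { intros x; destruct (flip_cases u v x h0 h1) as [(hx & e)|(hx & e)].
    - left; assert (hp := pres (flip u v x) ltac:(lra)).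
      rewrite (flip_in u v (f _)) by lra; lra.
    - right; split; [exact hx|]; apply xv_inj in e.
      rewrite e, hfix, e by exact hx; reflexivity. }
  intros x y hxy; pose proof (hf (flip u v y) (flip u v x)).
  destruct (cases x) as [(?&?&?&?)|(?&e)], (cases y) as [(?&?&?&?)|(?&e')];
    try rewrite e; try rewrite e'; lra.
Qed.

(** * The infinite repetition of a homeomorphism along an orbit *)

Section Repetition.
Variables s si : X -> X.
Variable a : X.
Hypothesis Hs : inverse_of s si.
Hypothesis Sinc : increasing s.
Hypothesis Ha : xv a < xv (s a).

(** These are successive fundamental domains of [s] along the forward orbit of [a], numbered from
    [0]. *)
Definition in_domain (n : nat) (x : X) : Prop :=
  xv (Nat.iter n s a) <= xv x < xv (Nat.iter (S n) s a).

Lemma orbit_lt i j : (i < j)%nat -> xv (Nat.iter i s a) < xv (Nat.iter j s a).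
Proof.
  assert (step : forall n, xv (Nat.iter n s a) < xv (Nat.iter (S n) s a)).
  { induction n as [|n IH]; [exact Ha|]; apply Sinc, IH. }
  induction 1 as [|j _ IH]; [apply step|]; pose proof (step j); lra.
Qed.

Lemma orbit_le i j : (i <= j)%nat -> xv (Nat.iter i s a) <= xv (Nat.iter j s a).
Proof.
  intros h; destruct (Nat.eq_dec i j) as [->|]; [apply Rle_refl|].
  apply Rlt_le, orbit_lt; lia.
Qed.

Lemma in_domain_inj i j x : in_domain i x -> in_domain j x -> i = j.
Proof.
  intros [h1 h2] [h3 h4]; destruct (Nat.lt_total i j) as [l|[e|g]]; [exfalso|exact e|exfalso].
  - pose proof (orbit_le (S i) j l); lra.
  - pose proof (orbit_le (S j) i g); lra.
Qed.

Lemma in_domain_S n x : in_domain (S n) (s x) <-> in_domain n x.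
Proof.
  assert (si_inc := increasing_inv _ _ Hs Sinc); destruct Hs as [s1 s2].
  assert (refl : forall u v, xv (s u) < xv (s v) <-> xv u < xv v).
  { intros u v; split; intros h; [|apply Sinc, h].
    apply si_inc in h; rewrite !s1 in h; exact h. }
  unfold in_domain; change (Nat.iter (S (S n)) s a) with (s (Nat.iter (S n) s a)).
  change (xv (s (Nat.iter n s a)) <= xv (s x) < xv (s (Nat.iter (S n) s a)) <->
          xv (Nat.iter n s a) <= xv x < xv (Nat.iter (S n) s a)).
  rewrite refl; pose proof (refl x (Nat.iter n s a)); lra.
Qed.

Lemma in_domain_iter n x : in_domain n (Nat.iter n s x) <-> in_domain 0 x.
Proof.
  induction n as [|n IH]; [tauto|]; rewrite <- IH; apply in_domain_S.
Qed.

Lemma iter_inv n x : Nat.iter n s (Nat.iter n si x) = x.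
Proof.
  revert x; induction n as [|n IH]; intros x; [reflexivity|].
  rewrite Nat.iter_succ_r; simpl; destruct Hs as [s1 s2]; rewrite s2; apply IH.
Qed.

Lemma iter_inv_l n x : Nat.iter n si (Nat.iter n s x) = x.
Proof.
  revert x; induction n as [|n IH]; intros x; [reflexivity|].
  rewrite Nat.iter_succ_r; simpl; destruct Hs as [s1 s2]; rewrite s1; apply IH.
Qed.

Lemma in_domain_pull n x : in_domain n x <-> in_domain 0 (Nat.iter n si x).
Proof. rewrite <- (in_domain_iter n), iter_inv; tauto. Qed.

(** For [f] supported in domain [0], this is the infinite product of its conjugates by the powers of
    [s]. Their supports are disjoint, so at most one factor acts at a point; choice selects its
    index. *)
Definition repeat_along (f : X -> X) (x : X) : X :=
  match excluded_middle_informative (exists n, in_domain n x) with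
  | left h =>
      let n := proj1_sig (constructive_indefinite_description _ h) in
      Nat.iter n s (f (Nat.iter n si x))
  | right _ => x
  end.

Lemma repeat_in f n x :
  in_domain n x -> repeat_along f x = Nat.iter n s (f (Nat.iter n si x)).
Proof.
  intros hn; unfold repeat_along.
  destruct (excluded_middle_informative _) as [h|h]; [|exfalso; eauto].
  destruct (constructive_indefinite_description _ h) as [k hk]; simpl.
  rewrite (in_domain_inj k n x hk hn); reflexivity.
Qed.

Lemma repeat_out f x : (forall n, ~ in_domain n x) -> repeat_along f x = x.
Proof.
  intros hn; unfold repeat_along.
  destruct (excluded_middle_informative _) as [[n h]|h]; [exfalso; eapply hn; eauto|reflexivity].
Qed.

Lemma repeat_domain f n x :
  (forall y, in_domain 0 y -> in_domain 0 (f y)) ->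
  in_domain n x -> in_domain n (repeat_along f x).
Proof.
  intros hf hn; rewrite (repeat_in f n x hn).
  apply in_domain_iter, hf, (proj1 (in_domain_pull n x)), hn.
Qed.

Lemma repeat_cancel f fi x :
  (forall y, fi (f y) = y) -> (forall y, in_domain 0 y -> in_domain 0 (f y)) ->
  repeat_along fi (repeat_along f x) = x.
Proof.
  intros hc hf; destruct (classic (exists n, in_domain n x)) as [[n hn]|hno].
  - assert (hd := repeat_domain f n x hf hn).
    rewrite (repeat_in fi n _ hd), (repeat_in f n x hn), iter_inv_l, hc; apply iter_inv.
  - rewrite !(repeat_out _ x); [reflexivity| |]; intros n hn; apply hno; exists n; exact hn.
Qed.

Lemma above_orbit x :
  (forall n, ~ in_domain n x) -> xv a <= xv x -> forall n, xv (Nat.iter n s a) <= xv x.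
Proof.
  intros hno h n; induction n as [|n IH]; [exact h|].
  destruct (Rle_dec (xv (Nat.iter (S n) s a)) (xv x)) as [|hn]; [assumption|].
  exfalso; apply (hno n); split; lra.
Qed.

Lemma repeat_increasing f :
  increasing f -> (forall y, in_domain 0 y -> in_domain 0 (f y)) ->
  increasing (repeat_along f).
Proof.
  intros hinc hf x y hxy.
  assert (iter_inc : forall g, increasing g -> forall n u v, xv u < xv v ->
            xv (Nat.iter n g u) < xv (Nat.iter n g v)).
  { intros g hg n u v huv; induction n; [exact huv|]; apply hg; assumption. }
  assert (si_inc := increasing_inv _ _ Hs Sinc).
  destruct (classic (exists n, in_domain n x)) as [[n hn]|hx];
  destruct (classic (exists n, in_domain n y)) as [[k hk]|hy].
  - assert (h1 := repeat_domain f n x hf hn); assert (h2 := repeat_domain f k y hf hk).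
    destruct (Nat.lt_total n k) as [l|[e|g]].
    + pose proof (orbit_le (S n) k l); unfold in_domain in *; lra.
    + subst k; rewrite !(repeat_in f n) by assumption.
      apply iter_inc; [exact Sinc|]; apply hinc, iter_inc; assumption.
    + pose proof (orbit_le (S k) n g); unfold in_domain in *; lra.
  - assert (hy' : forall m, ~ in_domain m y) by (intros m hm; apply hy; exists m; exact hm).
    assert (h1 := repeat_domain f n x hf hn); rewrite (repeat_out f y hy').
    pose proof (orbit_le 0 n (Nat.le_0_l n)); unfold in_domain in hn, h1; simpl in *.
    (* Above [a] and in no domain, the point [y] lies beyond the whole orbit. *)
    pose proof (above_orbit y hy' ltac:(lra) (S n)); simpl in *; lra.
  - assert (hx' : forall m, ~ in_domain m x) by (intros m hm; apply hx; exists m; exact hm).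
    assert (h1 := repeat_domain f k y hf hk); rewrite (repeat_out f x hx').
    pose proof (orbit_le 0 k (Nat.le_0_l k)).
    destruct (Rle_dec (xv a) (xv x)) as [hle|hn].
    + pose proof (above_orbit x hx' hle (S k)); unfold in_domain in *; lra.
    + unfold in_domain in h1; simpl in *; lra.
  - rewrite !repeat_out; [exact hxy| |]; intros m hm; [apply hy|apply hx]; exists m; exact hm.
Qed.

(* The conjugate by [s] of the repetition of [f] is the repetition without its
   first copy. *)
Lemma repeat_commutator f fi x :
  inverse_of f fi -> (forall y, ~ in_domain 0 y -> f y = y) ->
  (forall y, in_domain 0 y -> in_domain 0 (fi y)) ->
  repeat_along f (s (repeat_along fi (si x))) = f x.
Proof.
  intros [f1 f2] hout hfi; assert (Hs' := Hs); destruct Hs' as [s1 s2].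
  destruct (classic (exists n, in_domain n x)) as [[n hn]|hno].
  - destruct n as [|n].
    (* In domain [0], [si x] lies in no domain, so only the outer repetition acts. *)
    + rewrite (repeat_out fi (si x)).
      * rewrite s2; exact (repeat_in f 0 x hn).
      * intros n hn'; assert (h : in_domain (S n) x)
          by (rewrite <- (s2 x); apply in_domain_S; exact hn').
        discriminate (in_domain_inj _ _ _ hn h).
    (* In a later domain the copies of [fi] and [f] cancel, and [f] fixes [x]. *)
    + assert (hn' : in_domain n (si x)) by (apply in_domain_S; rewrite s2; exact hn).
      assert (hd : in_domain (S n) (s (repeat_along fi (si x))))
        by (apply in_domain_S, repeat_domain; assumption).
      rewrite (repeat_in f (S n) _ hd), (repeat_in fi n _ hn').
      change (s (Nat.iter n s (fi (Nat.iter n si (si x)))))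
        with (Nat.iter (S n) s (fi (Nat.iter n si (si x)))).
      rewrite iter_inv_l, f2, <- Nat.iter_succ_r, iter_inv.
      symmetry; apply hout; intros h; discriminate (in_domain_inj _ _ _ hn h).
  - assert (hx : forall m, ~ in_domain m x) by (intros m hm; apply hno; exists m; exact hm).
    rewrite (repeat_out fi (si x)).
    + rewrite s2, repeat_out by exact hx; symmetry; apply hout, hx.
    + intros m hm; apply (hx (S m)); rewrite <- (s2 x); apply in_domain_S; exact hm.
Qed.

End Repetition.

(** * Increasing homeomorphisms in the normal subgroup *)

Section IncreasingInH.
Variable H : (X -> X) -> Prop.
Hypothesis HN : quot_normal_subgroup in_PC_hat H.
Hypothesis Hflip : forall a b, 0 <= a -> a < b -> b <= 1 -> H (flip a b).

Lemma increasing_normalizes f fi : inverse_of f fi -> increasing f -> normalizes H f fi.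
Proof.
  intros hi hf; apply (G_normalizes _ H HN); [| |exact hi].
  - apply increasing_PC; [exists fi|]; assumption.
  - apply increasing_PC; [exists f; apply inverse_sym|apply (increasing_inv f)]; assumption.
Qed.

(** The window is a fundamental domain of a one-break map [s] sending [5 / 8] to [3 / 4]. Both [s]
    and the repetition of [f] are supported in the right half, so their commutator [f] is in [H]. *)
Lemma increasing_in_H_window f fi :
  inverse_of f fi -> increasing f ->
  (forall x, ~ (5 / 8 <= xv x < 3 / 4) -> f x = x) -> H f.
Proof.
  intros hi hf hout.
  set (s := onebreak (1 / 2) (7 / 8) (5 / 8) (3 / 4)).
  set (si := onebreak (1 / 2) (7 / 8) (3 / 4) (5 / 8)).
  assert (ok : ob_ok (1 / 2) (7 / 8) (5 / 8) (3 / 4)) by (repeat split; lra).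
  assert (hs : inverse_of s si) by (apply onebreak_inverse, ok).
  assert (sinc : increasing s) by (apply onebreak_increasing, ok).
  set (a := toX (5 / 8)); assert (ea : xv a = 5 / 8) by (apply xv_toX; lra).
  assert (esa : xv (s a) = 3 / 4).
  { unfold s; rewrite (onebreak_lo _ _ _ _ _ ok) by lra; rewrite ea, aff_r; lra. }
  assert (dom : forall x, in_domain s a 0 x <-> 5 / 8 <= xv x < 3 / 4).
  { intros x; unfold in_domain; simpl; rewrite ea, esa; tauto. }
  assert (ha : xv a < xv (s a)) by lra.
  assert (hout' : forall y, ~ in_domain s a 0 y -> f y = y).
  { intros y hy; apply hout; rewrite <- dom; exact hy. }
  assert (houti : forall y, ~ in_domain s a 0 y -> fi y = y).
  { intros y hy; rewrite <- (hout' y hy) at 1; apply hi. }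
  assert (pres : forall y, in_domain s a 0 y -> in_domain s a 0 (f y)).
  { intros y hy; apply NNPP; intros hn; assert (e := houti _ hn).
    rewrite (proj1 hi) in e; rewrite <- e in hn; exact (hn hy). }
  assert (presi : forall y, in_domain s a 0 y -> in_domain s a 0 (fi y)).
  { intros y hy; apply NNPP; intros hn; assert (e := hout' _ hn).
    rewrite (proj2 hi) in e; rewrite <- e in hn; exact (hn hy). }
  set (F := repeat_along s si a f); set (Fi := repeat_along s si a fi).
  assert (hF : inverse_of F Fi).
  { split; intros x; apply repeat_cancel; auto; apply hi. }
  assert (Finc : increasing F) by (apply repeat_increasing; assumption).
  refine (H_ext H _ _ (commutator_right_half_in_H _ H HN Hflip F Fi s si _ _ _ _) _).
  - apply increasing_normalizes; assumption.
  - apply increasing_normalizes; assumption.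
  - intros x hx; apply repeat_out; intros n [hn _].
    pose proof (orbit_le s a sinc ha 0 n (Nat.le_0_l n)); simpl in *; lra.
  - intros x hx; apply onebreak_out; lra.
  - intros x; symmetry; apply repeat_commutator; assumption.
Qed.

(** Two one-break maps carry [a] to [5 / 8] and [b] to [11 / 16]; conjugation by them moves the
    support into the window. *)
Lemma increasing_in_H_compact f fi a b :
  inverse_of f fi -> increasing f -> 0 < a -> a < b -> b < 1 ->
  (forall x, xv x < a \/ b < xv x -> f x = x) -> H f.
Proof.
  intros hi hf ha hab hb hout.
  assert (ok1 : ob_ok 0 1 a (5 / 8)) by (repeat split; lra).
  set (b' := aff a 1 (5 / 8) 1 b).
  assert (hb' : 5 / 8 < b' < 1) by (apply aff_between; lra).
  assert (ok2 : ob_ok (5 / 8) 1 b' (11 / 16)) by (repeat split; lra).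
  set (k := fun x => onebreak (5 / 8) 1 b' (11 / 16) (onebreak 0 1 a (5 / 8) x)).
  set (ki := fun x => onebreak 0 1 (5 / 8) a (onebreak (5 / 8) 1 (11 / 16) b' x)).
  assert (hk : inverse_of k ki).
  { apply (inverse_comp (onebreak (5 / 8) 1 b' (11 / 16)) (onebreak (5 / 8) 1 (11 / 16) b')
             (onebreak 0 1 a (5 / 8)) (onebreak 0 1 (5 / 8) a)); apply onebreak_inverse; assumption. }
  assert (kinc : increasing k).
  { apply (increasing_comp (onebreak (5 / 8) 1 b' (11 / 16)) (onebreak 0 1 a (5 / 8)));
      apply onebreak_increasing; assumption. }
  assert (kiinc := increasing_inv _ _ hk kinc).
  apply (normalizes_conj_iff H k ki f); [apply increasing_normalizes; assumption|].
  apply (increasing_in_H_window _ (fun x => k (fi (ki x)))).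
  - apply (inverse_comp k ki (fun x => f (ki x)) (fun x => k (fi x)) hk).
    apply (inverse_comp f fi ki k hi), inverse_sym, hk.
  - apply (increasing_comp k (fun x => f (ki x))); [exact kinc|].
    apply (increasing_comp f ki); assumption.
  - intros x hx; rewrite hout; [apply hk|].
    assert (ka : xv (k (toX a)) = 5 / 8).
    { assert (e : xv (onebreak 0 1 a (5 / 8) (toX a)) = 5 / 8).
      { rewrite (onebreak_lo _ _ _ _ _ ok1); rewrite xv_toX; try rewrite aff_r; lra. }
      unfold k; rewrite onebreak_out; lra. }
    assert (kb : xv (k (toX b)) = 11 / 16).
    { assert (e : xv (onebreak 0 1 a (5 / 8) (toX b)) = b').
      { rewrite (onebreak_hi _ _ _ _ _ ok1); rewrite xv_toX; try reflexivity; lra. }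
      unfold k; rewrite (onebreak_lo _ _ _ _ _ ok2); rewrite e; [apply aff_r|]; lra. }
    assert (xv x < 5 / 8 \/ 11 / 16 < xv x) as [h|h] by lra; [left|right].
    + rewrite <- ka in h; apply kiinc in h.
      rewrite (proj1 hk), xv_toX in h; lra.
    + rewrite <- kb in h; apply kiinc in h.
      rewrite (proj1 hk), xv_toX in h; lra.
Qed.

Lemma conj_flip_in_H f fi u v :
  inverse_of f fi -> 0 <= u -> u < v -> v <= 1 ->
  H (fun x => flip u v (f (flip u v x))) -> H f.
Proof.
  intros hi h0 huv h1; apply normalizes_conj_iff.
  apply (flip_normalizes _ H flip_class_PC HN); assumption.
Qed.

Lemma conj_flip_inverse f fi u v :
  inverse_of f fi -> 0 <= u -> v <= 1 ->
  inverse_of (fun x => flip u v (f (flip u v x))) (fun x => flip u v (fi (flip u v x))).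
Proof.
  intros [h1 h2] h0 hv; split; intros x; rewrite flip_invol, ?h1, ?h2, flip_invol; auto.
Qed.

(** The flip of [(0, v)], with [v] between [z] and [1], moves the support away from [0], into
    [[v - z, v]]. *)
Lemma increasing_in_H_left f fi z :
  inverse_of f fi -> increasing f -> 0 < z < 1 -> (forall x, z <= xv x -> f x = x) -> H f.
Proof.
  intros hi hf hz hout; set (v := (1 + z) / 2).
  assert (hb : bij f) by (exists fi; exact hi).
  assert (hv : z < v < 1) by (unfold v; lra).
  assert (hfix : forall x, xv x <= 0 \/ v <= xv x -> f x = x).
  { intros x [hx|hx]; [|apply hout; lra].
    pose proof (xv_range x); apply increasing_zero; lra || assumption. }
  apply (conj_flip_in_H f fi 0 v); try lra; [exact hi|].
  apply (increasing_in_H_compact _ (fun x => flip 0 v (fi (flip 0 v x))) (v - z) v); try lra.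
  - apply conj_flip_inverse; lra || assumption.
  - apply increasing_conj_flip; lra || assumption.
  - intros x hx; pose proof (xv_range x).
    destruct (flip_cases 0 v x) as [(h & e)|(h & e)]; try lra.
    + rewrite hout by lra; apply flip_invol; lra.
    + apply xv_inj in e; rewrite e, hfix, e by lra; reflexivity.
Qed.

(** The flip of [(c / 2, 1)] moves the support away from [1]. *)
Lemma increasing_in_H_right f fi c :
  inverse_of f fi -> increasing f -> 0 < c < 1 -> (forall x, xv x <= c -> f x = x) -> H f.
Proof.
  intros hi hf hc hout.
  assert (hb : bij f) by (exists fi; exact hi).
  assert (hfix : forall x, xv x <= c / 2 \/ 1 <= xv x -> f x = x).
  { intros x hx; pose proof (xv_range x); apply hout; lra. }
  apply (conj_flip_in_H f fi (c / 2) 1); try lra; [exact hi|].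
  apply (increasing_in_H_compact _ (fun x => flip (c / 2) 1 (fi (flip (c / 2) 1 x)))
           (c / 2) (1 - c / 2)); try lra.
  - apply conj_flip_inverse; lra || assumption.
  - apply increasing_conj_flip; lra || assumption.
  - intros x hx; pose proof (xv_range x).
    destruct (flip_cases (c / 2) 1 x) as [(h & e)|(h & e)]; try lra.
    + rewrite hout by lra; apply flip_invol; lra.
    + apply xv_inj in e; rewrite e, hfix, e by lra; reflexivity.
Qed.

(** The patch [g] agrees with [f] up to [1 / 2] and is the identity near [1], so [f] is [g] times a
    map that is the identity up to [1 / 2]. *)
Lemma increasing_in_H f : bij f -> increasing f -> H f.
Proof.
  intros hb hf; destruct hb as [fi hi]; assert (hb : bij f) by (exists fi; exact hi).
  assert (hfi := increasing_inv _ _ hi hf).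
  set (h := toX (1 / 2)); assert (eh : xv h = 1 / 2) by (apply xv_toX; lra).
  set (n := xv (f h)); set (z := (1 + Rmax (1 / 2) n) / 2).
  assert (f0 : xv (f (toX 0)) = 0).
  { rewrite increasing_zero; rewrite ?xv_toX; lra || assumption. }
  assert (hn : 0 < n < 1).
  { split; [rewrite <- f0; apply hf; rewrite xv_toX; lra|apply xv_range]. }
  pose proof (Rmax_l (1 / 2) n); pose proof (Rmax_r (1 / 2) n).
  assert (Rmax (1 / 2) n < 1) by (apply Rmax_lub_lt; lra).
  assert (hz : 1 / 2 < z /\ n < z /\ z < 1) by (unfold z; lra).
  assert (ok1 : patch_ok f 0 (1 / 2) n z).
  { repeat split; try lra.
    - rewrite <- f0; apply hf; rewrite xv_toX; lra.
    - apply hf; lra. }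
  assert (ok2 : patch_ok fi 0 n (1 / 2) z).
  { repeat split; try lra.
    - assert (h0 : xv (f (toX 0)) < xv x) by lra.
      apply hfi in h0; rewrite (proj1 hi), xv_toX in h0; lra.
    - assert (h0 : xv x < xv (f h)) by (unfold n in *; lra).
      apply hfi in h0; rewrite (proj1 hi) in h0; lra. }
  set (g := patch f 0 (1 / 2) n z); set (gi := patch fi 0 n (1 / 2) z).
  assert (hg : inverse_of g gi) by (split; intros x; apply patch_cancel; auto; intros; apply hi).
  assert (ginc : increasing g) by (apply patch_increasing; [exact ok1|intros; apply hf; assumption]).
  refine (H_ext H _ _ (H_comp _ H HN g (fun x => gi (f x)) _ _) _).
  - apply (increasing_in_H_left g gi z hg ginc); [lra|]; intros x hx.
    destruct (patch_cases _ _ _ _ _ x ok1) as [?|[?|[?|(_ & e)]]]; try lra; exact e.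
  - apply (increasing_in_H_right _ (fun x => fi (g x)) (1 / 2)).
    + apply (inverse_comp gi g f fi); [apply inverse_sym|]; assumption.
    + apply (increasing_comp gi f); [apply (increasing_inv g)|]; assumption.
    + lra.
    + intros x hx; pose proof (xv_range x).
      destruct (Req_dec (xv x) (1 / 2)) as [e|e].
      * assert (x = h) by (apply xv_inj; lra); subst x; apply xv_inj.
        assert (en : xv (f h) = n) by reflexivity.
        destruct (patch_cases _ _ _ _ _ (f h) ok2) as [?|[?|[(_ & _ & _ & e')|?]]];
          try lra.
        unfold gi; rewrite e', en, aff_l; lra.
      * destruct (Req_dec (xv x) 0) as [e0|e0].
        { rewrite (increasing_zero f x hb hf e0).
          apply increasing_zero; [exists g; apply inverse_sym, hg|apply (increasing_inv g)|];
            assumption. }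
        assert (0 < xv (f x)) by (rewrite <- f0; apply hf; rewrite xv_toX; lra).
        assert (xv (f x) < n) by (apply hf; lra).
        destruct (patch_cases _ _ _ _ _ (f x) ok2) as [?|[(_ & _ & e')|[?|?]]]; try lra.
        unfold gi; rewrite e'; apply hi.
  - intros x; symmetry; apply hg.
Qed.

End IncreasingInH.

(** * Simplicity of the piecewise continuous group *)

Definition any_piece (f : X -> X) (a b : R) : Prop := True.

(** The inverse of [f] on [(c, y)], extended affinely from [[y, 1)] onto [[d, 1)], is an increasing
    homeomorphism undoing the piece. *)
Lemma PC_straightens H :
  quot_normal_subgroup in_PC_hat H ->
  (forall a b, 0 <= a -> a < b -> b <= 1 -> H (flip a b)) ->
  straightens H any_piece.
Proof.
  intros HN Hflip f c d y l [fi hi] h0 hcd hcy hd hy hend _ hm hl.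
  destruct hm as (_ & m1 & m2 & m3).
  assert (back : forall x, c < xv x < y -> c < xv (fi x) < d).
  { intros x hx; destruct (m2 (xv x) hx) as (t & ht & e); apply xv_inj in e; subst.
    rewrite (proj1 hi); exact ht. }
  assert (ok1 : patch_ok fi c y d 1) by (repeat split; try lra; try tauto; apply back; lra).
  assert (ok2 : patch_ok f c d y 1) by (repeat split; try lra; try tauto; apply m1; lra).
  set (g := patch fi c y d 1).
  assert (hg : inverse_of g (patch f c d y 1))
    by (split; intros x; apply patch_cancel; auto; intros; apply hi).
  assert (gb : bij g) by (exists (patch f c d y 1); exact hg).
  assert (ginc : increasing g).
  { apply patch_increasing; [exact ok1|]; intros u v hu hv huv.
    assert (hu' := back u hu); assert (hv' := back v hv).
    destruct (Rtotal_order (xv (fi u)) (xv (fi v))) as [lt|[e|gt]]; [exact lt|exfalso|exfalso].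
    - apply xv_inj in e; assert (u = v) by (rewrite <- (proj2 hi u), e; apply hi); subst; lra.
    - specialize (m3 (fi v) (fi u) hv' hu' gt); simpl in m3; rewrite !(proj2 hi) in m3; lra. }
  exists g; split; [|split; [|split]].
  - apply (increasing_in_H H HN Hflip); assumption.
  - intros x hx; destruct (patch_cases _ _ _ _ _ x ok1) as [(_ & e)|[?|[?|?]]]; try lra; exact e.
  - intros x hx; assert (hr := m1 x hx).
    destruct (patch_cases _ _ _ _ _ (f x) ok1) as [?|[(_ & _ & e)|[?|?]]]; try lra.
    unfold g; rewrite e; apply hi.
  - revert hl; apply chain_impl; intros u v _ _ _ (_ & s & p & q & h2 & h3).
    assert (hq := maps_onto_le _ _ _ _ _ _ h2); assert (hpq := proj1 h2); split; [exact I|].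
    do 3 eexists; eapply maps_onto_comp; [exact h2|].
    apply maps_onto_increasing; lra || assumption.
Qed.

Lemma segment_between u v x y t :
  u < x < v -> u < y < v -> 0 <= t <= 1 -> u < x + t * (y - x) < v.
Proof. intros hx hy ht; destruct (Rle_dec x y); nra. Qed.

(** A continuous injection of an open interval is strictly monotone, and its image is the open
    interval between its infimum and supremum. *)
Lemma injective_continuous_maps_onto f u v :
  bij f -> 0 <= u -> u < v -> v <= 1 -> (forall x, u < xv x < v -> cont_at f x) ->
  exists s p q, maps_onto s f u v p q.
Proof.
  intros [fi hi] h0 huv h1 hc.
  set (phi := fun r => xv (f (toX r))).
  assert (phi_xv : forall x, phi (xv x) = xv (f x)) by (intros x; unfold phi; rewrite toX_xv; auto).
  assert (cont : forall r, u < r < v -> continuity_pt phi r).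
  { intros r hr eps heps; destruct (hc (toX r)) with (eps := eps) as (d & hd & hd');
      [rewrite xv_toX; lra|exact heps|].
    exists (Rmin d (Rmin (r - u) (v - r))); split; [repeat apply Rmin_pos; lra|].
    intros x [_ hx]; simpl in *; unfold R_dist in *.
    pose proof (Rmin_l d (Rmin (r - u) (v - r))); pose proof (Rmin_r d (Rmin (r - u) (v - r))).
    pose proof (Rmin_l (r - u) (v - r)); pose proof (Rmin_r (r - u) (v - r)).
    assert (hx' : Rabs (x - r) < Rmin (r - u) (v - r)) by lra; apply Rabs_def2 in hx'.
    apply hd'; rewrite !xv_toX; lra. }
  assert (inj : forall x y, u < x < v -> u < y < v -> phi x = phi y -> x = y).
  { intros x y hx hy e; unfold phi in e; apply xv_inj, (inverse_inj f fi _ _ hi) in e.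
    apply (f_equal xv) in e; rewrite !xv_toX in e; lra. }
  assert (ivt : forall x y z, u < x < v -> u < y < v -> phi x < z < phi y ->
            exists w, u < w < v /\ phi w = z).
  { intros x y z hx hy hz.
    assert (seg : forall t, 0 <= t <= 1 -> u < x + t * (y - x) < v) by (intros t ht; apply segment_between; assumption).
    destruct (IVT_interv (fun t => phi (x + t * (y - x)) - z) 0 1) as [t [ht et]].
    - intros t ht; apply continuity_pt_minus; [|apply continuity_pt_const; intros ? ?; auto].
      apply (continuity_pt_comp (fun t => x + t * (y - x)) phi); [reg|apply cont, seg, ht].
    - lra.
    - replace (x + 0 * (y - x)) with x by ring; lra.
    - replace (x + 1 * (y - x)) with y by ring; lra.
    - exists (x + t * (y - x)); split; [apply seg, ht|lra]. }
  (* Sliding the pair [x < y] linearly to [x' < y'] keeps it ordered, while the difference of the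
     values changes sign and so vanishes somewhere, against injectivity. *)
  assert (same : forall x y x' y', u < x < v -> u < y < v -> u < x' < v -> u < y' < v ->
            x < y -> x' < y' -> phi x < phi y -> phi y' < phi x' -> False).
  { intros x y x' y' hx hy hx' hy' hxy hxy' l l'.
    set (P := fun t => x + t * (x' - x)); set (Q := fun t => y + t * (y' - y)).
    assert (hP : forall t, 0 <= t <= 1 -> u < P t < v) by (intros t ht; apply segment_between; assumption).
    assert (hQ : forall t, 0 <= t <= 1 -> u < Q t < v) by (intros t ht; apply segment_between; assumption).
    destruct (IVT_interv (fun t => phi (P t) - phi (Q t)) 0 1) as [t [ht et]].
    - intros t ht; apply continuity_pt_minus.
      + apply (continuity_pt_comp P phi); [unfold P; reg|apply cont, hP, ht].
      + apply (continuity_pt_comp Q phi); [unfold Q; reg|apply cont, hQ, ht].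
    - lra.
    - replace (P 0) with x by (unfold P; ring); replace (Q 0) with y by (unfold Q; ring); lra.
    - replace (P 1) with x' by (unfold P; ring); replace (Q 1) with y' by (unfold Q; ring); lra.
    - assert (e : P t = Q t) by (apply inj; [apply hP|apply hQ|]; lra).
      unfold P, Q in e; assert (0 <= t * (y' - x')) by (apply Rmult_le_pos; lra).
      destruct (Req_dec t 1) as [->|]; [lra|].
      assert (0 < (1 - t) * (y - x)) by (apply Rmult_lt_0_compat; lra); lra. }
  set (r1 := (2 * u + v) / 3); set (r2 := (u + 2 * v) / 3).
  assert (hr1 : u < r1 < v) by (unfold r1; lra); assert (hr2 : u < r2 < v) by (unfold r2; lra).
  assert (hr : r1 < r2) by (unfold r1, r2; lra).
  assert (mono : exists s : bool, forall x y, u < x < v -> u < y < v -> x < y ->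
            if s then phi x < phi y else phi y < phi x).
  { destruct (Rlt_dec (phi r1) (phi r2)) as [l|n]; [exists true|exists false];
      intros x y hx hy hxy; destruct (Rtotal_order (phi x) (phi y)) as [a|[a|a]]; try assumption.
    1, 4: apply inj in a; lra.
    1: exfalso; apply (same r1 r2 x y); assumption.
    exfalso; apply (same x y r1 r2); try assumption.
    assert (phi r1 <> phi r2) by (intros e; apply inj in e; lra); lra. }
  destruct mono as [s mono].
  (* No value is extremal, so the supremum and the infimum are not attained. *)
  assert (bigger : forall x, u < x < v -> exists y, u < y < v /\ phi x < phi y).
  { intros x hx; destruct s.
    - exists ((x + v) / 2); split; [lra|]; apply mono; lra.
    - exists ((u + x) / 2); split; [lra|]; apply mono; lra. }
  assert (smaller : forall x, u < x < v -> exists y, u < y < v /\ phi y < phi x).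
  { intros x hx; destruct s.
    - exists ((u + x) / 2); split; [lra|]; apply mono; lra.
    - exists ((x + v) / 2); split; [lra|]; apply mono; lra. }
  assert (rng : forall x, 0 <= phi x < 1) by (intros x; apply xv_range).
  destruct (completeness (fun z => exists x, u < x < v /\ z = phi x)) as [q [q1 q2]].
  { exists 1; intros z (x & _ & ->); pose proof (rng x); lra. }
  { exists (phi r1), r1; auto. }
  (* The infimum is obtained as [- p], with [p] the supremum of the opposite values. *)
  destruct (completeness (fun z => exists x, u < x < v /\ z = - phi x)) as [p [p1 p2]].
  { exists 0; intros z (x & _ & ->); pose proof (rng x); lra. }
  { exists (- phi r1), r1; auto. }
  assert (bound : forall x, u < x < v -> - p < phi x < q).
  { intros x hx; destruct (bigger x hx) as (y & hy & l), (smaller x hx) as (y' & hy' & l').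
    assert (phi y <= q) by (apply q1; exists y; auto).
    assert (- phi y' <= p) by (apply p1; exists y'; auto); lra. }
  exists s, (- p), q; split; [|split; [|split]].
  - pose proof (bound r1 hr1); lra.
  - intros x hx; rewrite <- phi_xv; apply bound, hx.
  - intros z hz.
    assert (exists y, u < y < v /\ z < phi y) as (y & hy & ly).
    { apply NNPP; intros hn; assert (q <= z); [|lra].
      apply q2; intros t (x & hx & ->); apply Rnot_lt_le; intros l; apply hn; exists x; auto. }
    assert (exists y, u < y < v /\ phi y < z) as (y' & hy' & ly').
    { apply NNPP; intros hn; assert (p <= - z); [|lra].
      apply p2; intros t (x & hx & ->); apply Rnot_lt_le; intros l; apply hn; exists x.
      split; [exact hx|lra]. }
    destruct (ivt y' y z hy' hy (conj ly' ly)) as (w & hw & e).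
    exists (toX w); rewrite xv_toX by lra; split; assumption.
  - intros x y hx hy hxy; rewrite <- !phi_xv; apply mono; assumption.
Qed.

Lemma PC_pieces f : in_PC_hat f -> exists l, chain (piece any_piece f) 0 l 1.
Proof.
  intros hf; destruct (PC_cont f hf) as [L hL].
  destruct (chain_avoiding L 0 1 ltac:(lra)) as [l hl]; exists l.
  revert hl; apply chain_impl; intros u v hu huv hv hz; split; [exact I|].
  apply injective_continuous_maps_onto; try assumption; [apply hf|].
  intros x hx; apply hL, hz, hx.
Qed.

Lemma PC_simple : quot_simple in_PC_hat.
Proof.
  apply (quot_simple_of_straightens _ any_piece flip_class_PC); auto using PC_pieces, PC_straightens.
  intros s f g a b p q _ _ _; exact I.
Qed.

Theorem theorem1p4 : quot_simple in_PC_hat /\ quot_simple in_PAff_hat.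
Proof. exact (conj PC_simple PAff_simple). Qed.
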